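(* Let $s\in\mathbb{N}$ and let $f:[0,1]^s\to\mathbb{R}$ have continuous mixed partial derivatives up to order $2$ in each variable $x_j$, $j\in\{1,\dots,s\}$. Let $\mu=\int_{[0,1]^s}f(\boldsymbol{x})\,\mathrm{d}\boldsymbol{x}$. For each $m\in\mathbb{N}$ let $n=2^m$, let $\mathcal{C}^{(m)}=(C_1,\dots,C_s)$ be a tuple of generator matrices in $\{0,1\}^{m\times m}$, and let $\hat\mu$ be the resulting scrambled net estimate of $\mu$ based on $n$ points (defined in the context). Assume that $\mathbb{E}((\hat\mu-\mu)^2)>0$ for every $m$ and that the variance satisfies $\mathbb{E}((\hat\mu-\mu)^2)=\Omega(n^{-3})$. Let $$\gamma=\frac{\mathbb{E}((\hat\mu-\mu)^3)}{\mathbb{E}((\hat\mu-\mu)^2)^{3/2}}$$ be the skewness of $\hat\mu$. (i) If there is a constant $t\in\mathbb{N}_0$ such that for all sufficiently large $m$ the matrices $\mathcal{C}^{(m)}$ generate a $(t,m,s)$-net in base $2$, then $\gamma=O(n^{\epsilon})$ for any $\epsilon>0$. (ii) Let $\epsilon>0$. If either $s\le2$ and the hypothesis of (i) holds, or there is $\epsilon'\in(0,\epsilon/2)$ such that $\mathcal{C}^{(m)}\in\mathcal{C}^*_{m,\epsilon'}$ for all sufficiently large $m$ (with $\mathcal{C}^*_{m,\epsilon'}$ defined in the context), then $\gamma=O(n^{-1/2+\epsilon})$.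
   Context: Smoothness: all partial derivatives $\partial^{a_1+\cdots+a_s}f/\partial x_1^{a_1}\cdots\partial x_s^{a_s}$ with $(a_1,\dots,a_s)\in\{0,1,2\}^s$ exist and are continuous on $[0,1]^s$. Notation: $\mathbb{N}_0=\{0,1,2,\dots\}$. $a_n=O(b_n)$ means $|a_n|\le c|b_n|$ for some $c<\infty$ and all large $n$; in that case also $b_n=\Omega(a_n)$. Limits are as $n=2^m\to\infty$. Estimate: for $i\in\{0,\dots,2^m-1\}$ with $i=\sum_{\ell=1}^m i_\ell2^{\ell-1}$, $i_\ell\in\{0,1\}$, let $\vec i=(i_1,\dots,i_m)^{\mathsf T}$. Let $M_1,\dots,M_s\in\{0,1\}^{\infty\times m}$ be random matrices with ones on the diagonal, zeros above the diagonal, and uniform random elements of $\{0,1\}$ below the diagonal; let $\vec D_1,\dots,\vec D_s\in\{0,1\}^{\infty}$ be random vectors with uniform $\{0,1\}$ entries; all these random entries are mutually independent. Set $\vec x_{ij}=M_jC_j\vec i+\vec D_j \bmod 2$, let $x_{ij}=\sum_{\ell\ge1}2^{-\ell}(\vec x_{ij})_\ell$, $\boldsymbol{x}_i=(x_{i1},\dots,x_{is})$, and $\hat\mu=\frac1n\sum_{i=0}^{n-1}f(\boldsymbol{x}_i)$ with $n=2^m$. Expectations are over the $M_j$ and $\vec D_j$; the $C_j$ are fixed. Nets: $\mathcal{C}=(C_1,\dots,C_s)$ generates a $(t,m,s)$-net in base $2$ (with $0\le t\le m$) if for all $q_1,\dots,q_s\in\mathbb{N}_0$ with $q_1+\cdots+q_s=m-t$,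 the $(m-t)\times m$ matrix formed by stacking the first $q_j$ rows of $C_j$, $j=1,\dots,s$, has full row rank over the field with $2$ elements. $t(\mathcal{C})$ is the smallest $t\in\mathbb{N}_0$ for which $\mathcal{C}$ generates a $(t,m,s)$-net in base $2$. Events: for $k\in\mathbb{N}_0$ with binary expansion $k=\sum_{\ell\ge1}a_\ell2^{\ell-1}$ let $\vec k=(a_1,a_2,\dots)^{\mathsf T}$. For $\boldsymbol{k}=(k_1,\dots,k_s)\in\mathbb{N}_0^s$, $\mathcal{Z}(\boldsymbol{k},\mathcal{C})$ is the event that $\sum_{j=1}^s\vec k_j^{\mathsf T}M_jC_j=\boldsymbol{0}\bmod 2$. The set $\mathcal{C}^*_{m,\epsilon'}$: the set of all $\mathcal{C}\in(\{0,1\}^{m\times m})^s$ such that $t(\mathcal{C})<s\log_2(m)$ and, for all pairs of distinct nonzero $\boldsymbol{k}_1,\boldsymbol{k}_2\in\mathbb{N}_0^s$, $$\Pr\bigl(\mathcal{Z}(\boldsymbol{k}_1,\mathcal{C})\cap\mathcal{Z}(\boldsymbol{k}_2,\mathcal{C})\bigr)\le 2^{-2(1-\epsilon')m},$$ the probability being over the $M_j$ with $\mathcal{C}$ fixed. *)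

(* Defs.v *)
From HB Require Import structures.
From mathcomp Require Import all_boot all_order all_algebra finmap.
From mathcomp Require Import all_classical all_reals all_analysis.

Set Implicit Arguments.
Unset Strict Implicit.
Unset Printing Implicit Defensive.
Import Order.TTheory GRing.Theory Num.Theory.
Import numFieldNormedType.Exports.
Local Open Scope classical_set_scope.
Local Open Scope ring_scope.

Definition cube (R : realType) (s : nat) : set 'rV[R]_s :=
  [set x | forall j, 0 <= x 0 j <= 1].

Section partial_derivatives.
Variables (R : realType) (s : nat).
Implicit Types (f g : 'rV[R]_s -> R) (x : 'rV[R]_s) (j : 'I_s).

Definition diff_quotient j g x (h : R) : R :=
  h^-1 * (g (x + h *: delta_mx 0 j) - g x).

(* Only increments that stay in the cube are used: the derivative is one-sided
   on the faces, and does not depend on the values of g outside the cube. *)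
Definition pd_filter j x : set_system R :=
  within [set h | cube (x + h *: delta_mx 0 j)] 0^'.

Definition pderivable j g x : Prop :=
  cvg (diff_quotient j g x @ pd_filter j x).

Definition pderiv j g : 'rV[R]_s -> R :=
  fun x => lim (diff_quotient j g x @ pd_filter j x).

(* w = [:: j1; ...; jk] stands for d/dx_j1 ( ... (d/dx_jk f)). *)
Fixpoint pderivs (w : seq 'I_s) f : 'rV[R]_s -> R :=
  if w is j :: w' then pderiv j (pderivs w' f) else f.

Fixpoint ex_pderivs (w : seq 'I_s) f : Prop :=
  if w is j :: w' then
    ex_pderivs w' f /\ forall x, cube x -> pderivable j (pderivs w' f) x
  else True.

(* The word of d^(a_1 + ... + a_s) / dx_1^a_1 ... dx_s^a_s. *)
Definition multi_word (a : 'I_s -> nat) : seq 'I_s :=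
  flatten [seq nseq (a j) j | j <- enum 'I_s].

Definition smooth2 f : Prop := forall a : {ffun 'I_s -> 'I_3},
  let w := multi_word (fun j => a j : nat) in
  ex_pderivs w f /\ {within @cube R s, continuous (pderivs w f)}.

End partial_derivatives.

(* The library has no Lebesgue measure on R^n: it is obtained here by iterating
   the binary product on tuples, starting from the unit mass on R^0. *)
Section cons_measure.
Context d (T : measurableType d) (R : realType).
Variables (n : nat) (m1 : {sigma_finite_measure set T -> \bar R}).
Variable m2 : {sigma_finite_measure set (n.-tuple T) -> \bar R}.

Let cons_pair (p : T * n.-tuple T) : n.+1.-tuple T := [tuple of p.1 :: p.2].

Let measurable_cons_pair : measurable_fun setT cons_pair.
Proof. exact: measurable_cons. Qed.

Definition cons_measure : set (n.+1.-tuple T) -> \bar R :=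
  pushforward (m1 \x m2)%E (fun p => [tuple of p.1 :: p.2]).

Let cons_measure_measure : {measure set (n.+1.-tuple T) -> \bar R} :=
  measure_function_pushforward__canonical__measure_function_Measure
    (m1 \x m2)%E measurable_cons_pair.

HB.instance Definition _ := isMeasure.Build _ _ _ cons_measure
  (@measure0 _ _ _ cons_measure_measure)
  (@measure_ge0 _ _ _ cons_measure_measure)
  (@measure_semi_sigma_additive _ _ _ cons_measure_measure).

Let cons_measure_sigma_finite : sigma_finite setT cons_measure.
Proof.
have /sigma_finiteP[F [TF ndF Foo]] := sigma_finiteT m1.
have /sigma_finiteP[G [TG ndG Goo]] := sigma_finiteT m2.
pose g (t : n.+1.-tuple T) : T * n.-tuple T := (thead t, [tuple of behead t]).
have gK : g \o cons_pair = id.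
  by apply/funext => -[x t]; congr (_, _); exact/val_inj.
have mg : measurable_fun setT g.
  by apply/measurable_fun_pairP; split;
    [exact: measurable_tnth|exact: measurable_behead].
exists (fun k => g @^-1` (F k `*` G k)).
  apply/seteqP; split => // t _.
  have [a _ Fa] : (\bigcup_i F i) (g t).1 by rewrite -TF.
  have [b _ Gb] : (\bigcup_i G i) (g t).2 by rewrite -TG.
  exists (maxn a b) => //; split.
    by move: Fa; exact/subsetPset/ndF/leq_maxl.
  by move: Gb; exact/subsetPset/ndG/leq_maxr.
move=> k; have [mF Fk] := Foo k; have [mG Gk] := Goo k; split.
  by rewrite -[X in measurable X]setTI; apply: mg => //; exact: measurableX.
rewrite /cons_measure /pushforward -comp_preimage gK preimage_id.
by rewrite product_measure1E// lte_mul_pinfty// ge0_fin_numE.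
Qed.

HB.instance Definition _ :=
  Measure_isSigmaFinite.Build _ _ _ cons_measure cons_measure_sigma_finite.

End cons_measure.

Fixpoint power_measure d (T : measurableType d) (R : realType)
    (m1 : {sigma_finite_measure set T -> \bar R}) (n : nat) :
    {sigma_finite_measure set (n.-tuple T) -> \bar R} :=
  if n is n'.+1 then cons_measure m1 (power_measure m1 n')
  else @dirac _ _ [tuple] R.

Section cube_integral.
Variables (R : realType) (s : nat).

Definition lebesgue_tuple :
    {sigma_finite_measure set (s.-tuple (measurableTypeR R)) -> \bar R} :=
  power_measure (@lebesgue_measure R) s.

Definition row_of_tuple (x : s.-tuple (measurableTypeR R)) : 'rV[R]_s :=
  \row_j tnth x j.

Definition cube_integral (f : 'rV[R]_s -> R) : R :=
  (\int[lebesgue_tuple]_(x in row_of_tuple @^-1` @cube R s)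
     f (row_of_tuple x))%R.

End cube_integral.

Definition bit (k l : nat) : bool := odd (k %/ 2 ^ l).

(* Arithmetic modulo 2 takes place in 'F_2; rows, columns and binary digits are
   numbered from 0. *)
Definition gen_matrices (s m : nat) := 'I_s -> 'M['F_2]_m.

Section nets.
Variables (s m : nat) (C : gen_matrices s m).

(* Bounding the q_j by m loses no generality: they add up to m - t <= m. *)
Definition is_net (t : nat) : bool :=
  (t <= m)%N &&
  [forall q : {ffun 'I_s -> 'I_m.+1}, (\sum_j q j == m - t)%N ==>
     row_free (\mxcol_(j < s) rowsub (widen_ord (leq_ord (q j))) (C j))].

Lemma is_net_exists : exists t, is_net t.
Proof.
exists m; rewrite /is_net leqnn subnn /=.
apply/forallP => q; apply/implyP => /eqP q0.
by rewrite /row_free eqn_leq rank_leq_row /=; apply: (@leq_trans 0); rewrite ?q0.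
Qed.

Definition t_value : nat := ex_minn is_net_exists.

End nets.

Section independence.
Context d (T : measurableType d) (R : realType) (P : probability T R).

Definition mutually_independent (K : choiceType) (I : set K) d'
    (T' : measurableType d') (X : K -> {RV P >-> T'}) : Prop :=
  forall (J : {fset K}) (B : K -> set T'),
    [set` J] `<=` I -> (forall i, measurable (B i)) ->
    P (\bigcap_(i in [set` J]) (X i @^-1` B i)) =
      (\prod_(i <- J) P (X i @^-1` B i))%E.

End independence.

Section scrambling.
Context d (T : measurableType d) (R : realType) (P : probability T R).
Variables s m : nat.

(* inl (j, l, c) is the entry of M_j in row l and column c,
   inr (j, l) is the entry l of D_j. *)
Definition entry_index := ('I_s * nat * 'I_m + 'I_s * nat)%type.

Definition random_entry : set entry_index :=
  [set e : entry_index | if e is inl (_, l, c) then (c < l)%N else True].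

Definition entry (M : 'I_s -> nat -> 'I_m -> {RV P >-> bool})
    (D : 'I_s -> nat -> {RV P >-> bool}) (e : entry_index) : {RV P >-> bool} :=
  match e with inl (j, l, c) => M j l c | inr (j, l) => D j l end.

Record scrambling := Scrambling {
  scr_mx : 'I_s -> nat -> 'I_m -> {RV P >-> bool};
  scr_shift : 'I_s -> nat -> {RV P >-> bool};
  scr_diag : forall j (c : 'I_m) w, scr_mx j c c w = true;
  scr_upper : forall j (l : nat) (c : 'I_m) w,
    (l < c)%N -> scr_mx j l c w = false;
  scr_uniform : forall e b, random_entry e ->
    P (entry scr_mx scr_shift e @^-1` [set b]) = (2^-1)%:E;
  scr_indep : mutually_independent random_entry (entry scr_mx scr_shift)
}.

Variables (S : scrambling) (C : gen_matrices s m).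

Definition scr_row (j : 'I_s) (l : nat) (w : T) : 'rV['F_2]_m :=
  \row_c (scr_mx S j l c w)%:R.

Definition net_digit (i : nat) (j : 'I_s) (l : nat) (w : T) : 'F_2 :=
  (scr_row j l w *m C j *m \col_(c < m) (bit i c)%:R) 0 0
  + (scr_shift S j l w)%:R.

Definition net_point (i : nat) (w : T) : 'rV[R]_s :=
  \row_j limn (series (fun l => (net_digit i j l w == 1)%:R / 2 ^+ l.+1 : R)).

Definition mu_hat (f : 'rV[R]_s -> R) (w : T) : R :=
  (2 ^ m)%:R^-1 * \sum_(i < 2 ^ m) f (net_point i w).

Definition error_moment (f : 'rV[R]_s -> R) (p : nat) : R :=
  fine 'E_P[fun w => (mu_hat f w - cube_integral f) ^+ p].

Definition skewness (f : 'rV[R]_s -> R) : R :=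
  error_moment f 3 / error_moment f 2 `^ (3 / 2).

(* The digits of k j with index l >= k j vanish. *)
Definition Zevent (k : {ffun 'I_s -> nat}) : set T :=
  [set w | \sum_j \sum_(l < k j) (bit (k j) l)%:R *: (scr_row j l w *m C j) = 0].

End scrambling.

Definition Cstar d (T : measurableType d) (R : realType) (P : probability T R)
    (s m : nat) (S : scrambling P s m) (eps' : R) : set (gen_matrices s m) :=
  [set C | (t_value C)%:R < s%:R * (ln m%:R / ln 2) :> R /\
    forall k1 k2 : {ffun 'I_s -> nat},
      k1 != [ffun=> 0%N] -> k2 != [ffun=> 0%N] -> k1 != k2 ->
      (P (Zevent S C k1 `&` Zevent S C k2)
        <= (2 `^ (- (2 * (1 - eps') * m%:R)))%:E)%E].

(* Main.v *)
Require Import Defs.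
From mathcomp Require Import all_boot all_order all_algebra finmap.
From mathcomp Require Import ring lra zify.
From mathcomp Require Import all_classical all_reals all_analysis.
From mathcomp Require Import measurable_realfun.
Set Implicit Arguments.
Unset Strict Implicit.
Unset Printing Implicit Defensive.
Import Order.TTheory GRing.Theory Num.Theory.
Import numFieldNormedType.Exports.
Local Open Scope ring_scope.

(** Walsh analysis turns the error into a random sum over nonzero frequencies k,
    vectors of binary digits: the Walsh coefficient of f at k, times a random
    sign given by the digital shift, times the indicator of the event that k
    annihilates the scrambled net. In the third moment, the average over the
    shift keeps only the triples k1, k2, k1 + k2, so that its size is at most
    the sum over pairs of the product of three coefficients and of the
    probability that k1 and k2 both annihilate the net.

    In one coordinate write a for the position of the leading digit of a
    frequency, the one of finest scale. Two bounded derivatives per variable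
    make the coefficients decay like the product over the coordinates of
    2^-(a + a'), a' being the position of the next one (walsh_coef_bound:
    by finite differences at these two digits). Among three frequencies with sum
    zero the two largest positions in a coordinate agree; call them A and the
    smallest one B, and let D be the sum of A + B over the coordinates. The
    products of three coefficients then sum up, for pairs with given A and B, to
    about 4^-D (weight_triple, sum_weights).

    The probability is bounded by translation: adding suitable matrices to the
    scrambling matrices preserves their law and moves the event to disjoint
    ones, so the probability is at most the inverse of the number of
    translations (joint_zvec_bound). The net property supplies about 2^r of
    them, where r = min(m, n1) + min(m, D - n1) for n1 the total degree of k1,
    and makes the probability zero unless the three frequencies have degree
    above m - t (zvec_neq0). The order of the third moment is thus governed by
    the minimum of r + 2D, up to terms that are small compared with m.
     - In general, averaging the bound for r over k1, k2 and k1 + k2 gives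
       r + 2D >= 9m/2 (nine_halves).
     - If s <= 2, then D >= 2m, since some pair of the three frequencies never
       holds both largest positions of a coordinate (joint_degree_le2); as
       r >= m, this gives 5m.
     - In the last case r = 2(1 - eps')m by hypothesis and D >= 3m/2, which
       gives (5 - 2 eps')m.
    Dividing by the power 3/2 of the variance, at least of order 2^(-3m), turns
    the exponents 9/2 and 5 into 0 and -1/2. To sum over all D at
    once, the probabilities are bounded with a factor (4 2^-delta)^D instead of
    4^D, for a small delta (damped_bound).

    Only finitely many digits are random at a time: f is replaced by its values
    at the corners of dyadic cells of side 2^-L, with an error that tends to
    zero with 2^-L, uniformly in the points (cube_lipschitz, riemann,
    third_moment_le), while the bounds do not depend on L. *)

(** * Leading digits of frequencies *)

Lemma bigmax_attained (I : finType) (Q : pred I) (F : I -> nat) :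
  (0 < \max_(i | Q i) F i -> exists2 i, Q i & \max_(i | Q i) F i = F i)%N.
Proof.
have [->//|//] : (\max_(i | Q i) F i)%N = 0%N \/
  exists2 i, Q i & (\max_(i | Q i) F i)%N = F i.
apply: (big_ind (fun x => x = 0%N \/ exists2 i, Q i & x = F i)).
- by left.
- by move=> x y hx hy; rewrite /maxn; case: ltnP.
- by move=> i Qi; right; exists i.
Qed.

Section digits.
Variable L : nat.
Implicit Types a b c k : 'rV['F_2]_L.

(** Positions are counted from 1, and 0 stands for a missing digit. In the
    frequency of digits k the last nonzero entry is the leading one. *)
Definition top k : nat := (\max_(l < L | k 0%R l != 0%R) l.+1)%N.
Definition second k : nat :=
  (\max_(l < L | (k 0%R l != 0%R) && (l.+1 < top k)) l.+1)%N.

Lemma F2_case (x : 'F_2) : x = 0 \/ x = 1.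
Proof.
case: x => -[|[|x]] // i; [left|right]; exact: val_inj.
Qed.

Lemma F2_addxx (x : 'F_2) : x + x = 0.
Proof. by case: (F2_case x) => ->; exact: val_inj. Qed.

Lemma F2_neq0 (x : 'F_2) : (x != 0) = (x == 1).
Proof. by case: (F2_case x) => ->. Qed.

Lemma rV2_addxx n p (a : 'M['F_2]_(n, p)) : a + a = 0.
Proof. by apply/matrixP => i j; rewrite !mxE F2_addxx. Qed.

Lemma leq_top k (l : 'I_L) : k 0 l != 0 -> (l < top k)%N.
Proof. move=> kl; exact: (@bigop.bigmax_sup _ l (fun l => k 0 l != 0) l.+1%N (fun l => l.+1%N)). Qed.

Lemma leq_second k (l : 'I_L) :
  k 0 l != 0 -> (l.+1 < top k)%N -> (l < second k)%N.
Proof. move=> kl lt.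
apply: (@bigop.bigmax_sup _ l (fun l => (k 0 l != 0) && (l.+1 < top k)%N)
  l.+1%N (fun l => l.+1%N)) => //.
by rewrite kl. Qed.

Lemma second_le_top k : (second k <= top k)%N.
Proof. by apply/bigmax_leqP => l /andP[_ /ltnW]. Qed.

Lemma top_le_L k : (top k <= L)%N.
Proof. by apply/bigmax_leqP => l _. Qed.

Lemma top_attained k : (0 < top k)%N ->
  exists2 l : 'I_L, k 0 l != 0 & top k = l.+1%N.
Proof.
exact: bigmax_attained.
Qed.

Lemma second_attained k : (0 < second k)%N ->
  exists l : 'I_L, [/\ k 0 l != 0, (l.+1 < top k)%N & second k = l.+1%N].
Proof.
by move=> /bigmax_attained[l /andP[kl lt] e]; exists l.
Qed.

Lemma top_eq0 k : (top k == 0%N) = (k == 0).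
Proof.
apply/idP/eqP => [/eqP t0|->].
  apply/rowP => l; rewrite mxE; apply/eqP/negPn/negP => /leq_top.
  by rewrite t0.
by apply/eqP/big_pred0 => l; rewrite mxE eqxx.
Qed.


Lemma top_add_eq a b : top a = top b ->
  (top (a + b)%R <= maxn (second a) (second b))%N.
Proof.
move=> eab; apply/bigmax_leqP => l; rewrite mxE => abl.
have lt_top : (l.+1 < top a)%N.
  have le_top : (l < top a)%N.
    have [al0|/leq_top//] := eqVneq (a 0 l) 0.
    by rewrite eab; apply: leq_top; move: abl; rewrite al0 add0r.
  rewrite ltn_neqAle le_top andbT; apply/eqP => lE.
  have ta : (0 < top a)%N by rewrite -lE.
  have tb : (0 < top b)%N by rewrite -eab.
  have [la al ea] := top_attained ta; have [lb bl eb] := top_attained tb.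
  have eal : la = l by apply: val_inj; apply: succn_inj; rewrite /= -ea -lE.
  have ebl : lb = l by apply: val_inj; apply: succn_inj; rewrite /= -eb -eab -lE.
  move: abl al bl; rewrite eal ebl !F2_neq0 => + /eqP a1 /eqP b1.
  by rewrite a1 b1.
rewrite leq_max; have [al0|al] := eqVneq (a 0 l) 0.
  apply/orP; right; apply: leq_second; first by move: abl; rewrite al0 add0r.
  by rewrite -eab.
by rewrite leq_second.
Qed.

Lemma top_add_lt a b : (top b < top a)%N -> top (a + b) = top a.
Proof.
move=> lba; apply/eqP; rewrite eqn_leq; apply/andP; split.
  apply/bigmax_leqP => l; rewrite mxE => abl.
  have [al0|/leq_top//] := eqVneq (a 0 l) 0.
  by apply: leq_trans (ltnW lba); apply: leq_top; move: abl; rewrite al0 add0r.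
have [l al ea] := top_attained (leq_ltn_trans (leq0n _) lba).
rewrite ea; apply: leq_top; rewrite mxE.
have [->|/leq_top] := eqVneq (b 0 l) 0; first by rewrite addr0.
by rewrite leqNgt -ea lba.
Qed.

(** Of three digit vectors adding up to zero, two have the same top digit; the
    third one then begins at or below one of their second digits. *)
Lemma top_triple a b c : a + b + c = 0 ->
  [\/ top a = top b /\ (top c <= maxn (second a) (second b))%N,
      top a = top c /\ (top b <= maxn (second a) (second c))%N |
      top b = top c /\ (top a <= maxn (second b) (second c))%N].
Proof.
have opp k : - k = k by apply/esym/eqP; rewrite -addr_eq0 rV2_addxx.
move=> abc; have cE : c = a + b by rewrite -[a + b](addrK c) abc sub0r opp.
have aE : a = b + c by rewrite cE addrCA rV2_addxx addr0.
have bE : b = a + c by rewrite cE addrA rV2_addxx add0r.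
case: (ltngtP (top b) (top a)) => [lba|lab|eab].
- have eac : top a = top c by rewrite cE top_add_lt.
  by apply: Or32; split=> //; rewrite bE top_add_eq.
- have ebc : top b = top c by rewrite cE addrC top_add_lt.
  by apply: Or33; split=> //; rewrite aE top_add_eq.
- by apply: Or31; split=> //; rewrite cE top_add_eq.
Qed.

End digits.

Section weights.
Variables (F : realFieldType) (L : nat).
Implicit Types (a b c k : 'rV['F_2]_L) (beta : F).

(** The decay rate of the Walsh coefficients of a function with two derivatives
    in each variable. *)
Definition weight k : F := 2 ^- (top k + second k).
Definition geo beta k : F := 2 ^- second k * beta ^+ top k.

(** When a + b + c = 0, the largest of the three top digits, which is attained
    twice, plus the smallest one. *)
Definition joint a b c : nat := (top a + minn (top b) (top c))%N.

Lemma weight_ge0 k : 0 <= weight k.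
Proof. by rewrite /weight invr_ge0 exprn_ge0. Qed.

Lemma geo_ge0 beta k : 0 <= beta -> 0 <= geo beta k.
Proof. by move=> b0; rewrite /geo mulr_ge0 ?exprn_ge0 ?invr_ge0 ?exprn_ge0. Qed.

Let weight_pair beta a b c : 0 <= beta -> top a = top b ->
  (top c <= second a)%N ->
  weight a * weight b * weight c * (4 * beta) ^+ (top a + top c) <=
  geo beta b * geo beta c.
Proof.
move=> b0 eab ca.
have p0 (n : nat) : 0 < 2 ^+ n :> F by rewrite exprn_gt0.
have -> : weight a * weight b * weight c * (4 * beta) ^+ (top a + top c) =
    2 ^+ top c / 2 ^+ second a * (geo beta b * geo beta c).
  rewrite /weight /geo -eab !(exprD, exprMn).
  have -> : 4 = 2 * 2 :> F by rewrite -natrM.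
  rewrite !exprMn.
  move: (p0 (top a)) (p0 (top c)) (p0 (second a)) (p0 (second b)).
  move: (p0 (second c)) (beta ^+ top a) (beta ^+ top c).
  move: (2 ^+ top a) (2 ^+ top c) (2 ^+ second a) (2 ^+ second b) (2 ^+ second c).
  by clear=> *; field; rewrite !gt_eqF.
apply: ler_piMl; first by rewrite mulr_ge0 ?geo_ge0.
rewrite ler_pdivrMr// mul1r.
by rewrite ler_eXn2l ?ltr1n.
Qed.

Let weight_pair_sym beta a b c : 0 <= beta -> top a = top b ->
  (top c <= maxn (second a) (second b))%N ->
  weight a * weight b * weight c * (4 * beta) ^+ (top a + top c) <=
  geo beta b * geo beta c + geo beta a * geo beta c.
Proof.
move=> b0 eab; rewrite leq_max => /orP[h|h].
  apply: le_trans (weight_pair b0 eab h) _.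
  by rewrite lerDl mulr_ge0 ?geo_ge0.
rewrite [weight a * _]mulrC eab.
apply: le_trans (weight_pair b0 (esym eab) h) _.
by rewrite lerDr mulr_ge0 ?geo_ge0.
Qed.

(** The two frequencies sharing the top digit A give 2^(-2A) and the third one
    2^(-B), so that after multiplication by 4^(A+B) only the factor 2^B and the
    second digits remain; one of the second digits is at least B and absorbs
    2^B. The sum over pairs of frequencies thereby splits into products. *)
Lemma weight_triple beta a b c : 0 <= beta -> a + b + c = 0 ->
  weight a * weight b * weight c * (4 * beta) ^+ joint a b c <=
  geo beta a * geo beta b + geo beta b * geo beta c + geo beta a * geo beta c.
Proof.
move=> b0 abc.
have gg u v : 0 <= geo beta u * geo beta v by rewrite mulr_ge0 ?geo_ge0.
have top_le (u v w : 'rV['F_2]_L) : (top w <= maxn (second u) (second v))%N -> top u = top v ->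
    (top w <= top u)%N.
  move=> h e; apply: leq_trans h _.
  by rewrite geq_max second_le_top e second_le_top.
rewrite /joint; case: (top_triple abc) => -[exy h]; have le := top_le _ _ _ h exy.
- rewrite -exy (minn_idPr le); apply: le_trans (weight_pair_sym b0 exy h) _.
  by rewrite -addrA lerDr.
- rewrite -exy (minn_idPl le) [weight a * weight b * _]mulrAC.
  apply: le_trans (weight_pair_sym b0 exy h) _.
  by rewrite [geo beta c * _]mulrC [leLHS]addrC lerDl.
- rewrite -exy minnn addnC -[weight a * _ * _]mulrA [weight a * _]mulrC.
  apply: le_trans (weight_pair_sym b0 exy h) _.
  rewrite [geo beta c * _]mulrC [geo beta b * geo beta a]mulrC.
  by rewrite [leLHS]addrC [leRHS]addrAC lerDl.
Qed.

(** The digits below the second one are free. *)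
Let card_top_second (A r : nat) :
  (#|[set k : 'rV['F_2]_L | (top k == A) && (second k == r)]| <= 2 ^ r)%N.
Proof.
pose g k : {ffun 'I_r -> 'F_2} :=
  [ffun i : 'I_r => oapp (k 0) 0 (insub (i : nat) : option 'I_L)].
have -> : (2 ^ r)%N = #|{ffun 'I_r -> 'F_2}| by rewrite card_ffun !card_ord.
apply: (leq_card_in g) => a b; rewrite !inE => /andP[/eqP ta /eqP sa].
move=> /andP[/eqP tb /eqP sb] /ffunP gab; apply/rowP => l.
have [lr|rl] := ltnP l r.
  have := gab (Ordinal lr); rewrite !ffunE /=.
  by rewrite (_ : insub (l : nat) = Some l) //; exact: valK.
have high k : top k = A -> second k = r -> (k 0 l != 0) = (l.+1 == A).
  move=> tk sk; apply/idP/eqP => [kl|lA].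
    apply/eqP; rewrite eqn_leq -tk leq_top //= leqNgt; apply/negP => lt.
    by have := leq_second kl lt; rewrite sk ltnNge rl.
  have [|i ki] := @top_attained _ k; first by rewrite tk -lA.
  rewrite tk -lA => -[il]; rewrite (_ : l = i) //; apply: val_inj => /=; move/eqP: lA; lia.
have := high _ tb sb; rewrite -(high _ ta sa) !F2_neq0.
case: (F2_case (a 0 l)) (F2_case (b 0 l)) => -> [] -> //.
Qed.

Lemma sum_geo beta : 0 <= beta < 1 ->
  \sum_(k : 'rV['F_2]_L) geo beta k <= ((1 - beta) ^+ 2)^-1.
Proof.
move=> /andP[b0 b1].
have lvl (A : 'I_L.+1) : \sum_(k : 'rV['F_2]_L | top k == A) geo beta k
    <= A.+1%:R * beta ^+ A.
  have lt_sec (k : 'rV['F_2]_L) : top k == A -> (second k < A.+1)%N.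
    by move=> /eqP <-; rewrite ltnS second_le_top.
  rewrite (partition_big (fun k : 'rV['F_2]_L => inord (second k) : 'I_A.+1)
    xpredT) //=.
  rewrite -[A.+1 in leRHS]card_ord -sumr_const mulr_suml ler_sum // => c _.
  rewrite mul1r (eq_bigr (fun=> 2 ^- c * beta ^+ A)); last first.
    move=> k /andP[tk /eqP <-]; rewrite /geo inordK ?lt_sec//.
    by rewrite (eqP tk).
  rewrite -big_distrl /=; apply: ler_piMl; rewrite ?exprn_ge0// sumr_const.
  rewrite -[_ *+ _]mulr_natl ler_pdivrMr ?exprn_gt0// mul1r -natrX ler_nat.
  apply: leq_trans (card_top_second A c); apply: subset_leq_card.
  apply/fintype.subsetP => k; rewrite !inE => /andP[tk /eqP <-].
  by rewrite tk inordK ?(lt_sec _ tk) /=.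
rewrite (partition_big (fun k : 'rV['F_2]_L => inord (top k) : 'I_L.+1) xpredT)
  //=.
apply: (@le_trans _ _ (\sum_(A < L.+1) A.+1%:R * beta ^+ A)).
  apply: ler_sum => A _; apply: le_trans (lvl A).
  rewrite le_eqVlt; apply/orP; left; apply/eqP; apply: eq_bigl => k.
  by rewrite -val_eqE /= inordK // ltnS top_le_L.
rewrite -[leRHS]mul1r ler_pdivlMr ?exprn_gt0 ?subr_gt0//.
have closed n : (\sum_(A < n) A.+1%:R * beta ^+ A) * (1 - beta) ^+ 2 =
    1 - n.+1%:R * beta ^+ n + n%:R * beta ^+ n.+1.
  elim: n => [|n IH]; first by rewrite big_ord0 mul0r expr0; ring.
  by rewrite big_ord_recr /= mulrDl IH !exprS -!natr1; ring.
rewrite closed.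
have : 0 <= beta ^+ L.+1 * (L.+2%:R - L.+1%:R * beta).
  rewrite mulr_ge0 ?exprn_ge0// subr_ge0.
  apply: (@le_trans _ _ L.+1%:R); last by rewrite ler_nat.
  by rewrite ler_piMr // ltW.
by rewrite [beta ^+ L.+2]exprS; lra.
Qed.

Lemma sum_weight_triple beta : 0 <= beta < 1 ->
  \sum_(a : 'rV['F_2]_L) \sum_(b : 'rV['F_2]_L)
    weight a * weight b * weight (a + b) * (4 * beta) ^+ joint a b (a + b)
  <= 3 * ((1 - beta) ^+ 2)^-1 ^+ 2.
Proof.
move=> /andP[b0 b1]; set G := \sum_(k : 'rV['F_2]_L) geo beta k.
have G0 : 0 <= G by apply: sumr_ge0 => k _; rewrite geo_ge0.
have Gle : G <= ((1 - beta) ^+ 2)^-1 by apply: sum_geo; rewrite b0.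
apply: (@le_trans _ _ (3 * G ^+ 2)); last first.
  by rewrite ler_pM2l // ler_sqr // nnegrE ?(le_trans G0).
have -> : 3 * G ^+ 2 =
  \sum_(a : 'rV['F_2]_L) \sum_(b : 'rV['F_2]_L) geo beta a * geo beta b +
  \sum_(a : 'rV['F_2]_L) \sum_(b : 'rV['F_2]_L) geo beta b * geo beta (a + b) +
  \sum_(a : 'rV['F_2]_L) \sum_(b : 'rV['F_2]_L) geo beta a * geo beta (a + b).
  have e1 : \sum_(a : 'rV['F_2]_L) \sum_(b : 'rV['F_2]_L) geo beta a * geo beta b
     = G * G.
    by rewrite mulr_suml; apply: eq_bigr => a _; rewrite mulr_sumr.
  have shift a : \sum_(b : 'rV['F_2]_L) geo beta (a + b) = G.
    by rewrite /G [in RHS](reindex_inj (addrI a)).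
  have e3 : \sum_(a : 'rV['F_2]_L) \sum_(b : 'rV['F_2]_L)
     geo beta a * geo beta (a + b) = G * G.
    by rewrite mulr_suml; apply: eq_bigr => a _; rewrite -mulr_sumr shift.
  have e2 : \sum_(a : 'rV['F_2]_L) \sum_(b : 'rV['F_2]_L)
     geo beta b * geo beta (a + b) = G * G.
    rewrite exchange_big -e3; apply: eq_bigr => b _; apply: eq_bigr => a _.
    by rewrite addrC.
  by rewrite e1 e2 e3; ring.
rewrite -!big_split; apply: ler_sum => a _; rewrite -!big_split.
apply: ler_sum => b _; apply: weight_triple => //; exact: rV2_addxx.
Qed.

End weights.

(** * Nets and scrambled rows *)

Lemma delta_dot (F : comNzRingType) L (k : 'rV[F]_L) (l : 'I_L) :
  k *m delta_mx l (0 : 'I_1) = (k 0 l)%:M.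
Proof.
apply/matrixP => i j; rewrite !mxE !ord1 eqxx mulr1n (bigD1 l) //= big1 ?addr0.
  by rewrite mxE !eqxx mulr1.
by move=> l' /negbTE ll'; rewrite mxE ll' mulr0.
Qed.

Lemma top_dual L (k : 'rV['F_2]_L) (q : nat) : (q <= (top k).-1)%N ->
  exists p : 'cV['F_2]_L, (forall l : 'I_L, (l < q)%N -> p l 0 = 0) /\
    ((0 < q)%N -> k *m p = 1%:M).
Proof.
case: q => [|q qk]; first by exists 0; split => // l; rewrite mxE.
have [|l kl tl] := @top_attained _ k; first lia.
exists (delta_mx l 0); split=> [i iq|_].
  by rewrite mxE; case: eqP => // il; move: iq; rewrite il; lia.
by rewrite delta_dot; move: kl; rewrite F2_neq0 => /eqP ->.
Qed.

(** The digits of a and b from position q on are linearly independent as soon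
    as b and a + b both have one, so that some functional supported there
    separates b from a. *)
Lemma top_dual_pair L (a b : 'rV['F_2]_L) (q : nat) :
  (q <= (minn (top b) (top (a + b)%R)).-1)%N ->
  exists p : 'cV['F_2]_L, (forall l : 'I_L, (l < q)%N -> p l 0 = 0) /\
    ((0 < q)%N -> a *m p = 0 /\ b *m p = 1%:M).
Proof.
case: q => [|q qk]; first by exists 0; split => // l; rewrite mxE.
have [|l bl tl] := @top_attained _ b; first lia.
have [|i ci ti] := @top_attained _ (a + b); first lia.
have low (r l' : 'I_L) : (q < r)%N -> (l' < q.+1)%N ->
    (delta_mx r (0 : 'I_1) : 'cV['F_2]_L) l' 0 = 0.
  by move=> qr lq; rewrite mxE; case: eqP => // il; move: lq; rewrite il; lia.
have lq : (q < l)%N by lia.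
have iq : (q < i)%N by lia.
move: bl ci; rewrite mxE !F2_neq0 => /eqP bl /eqP ci.
have z0 : (0 : 'F_2)%:M = 0 :> 'M['F_2]_1 by rewrite raddf0.
case: (F2_case (a 0 l)) => al.
  exists (delta_mx l 0); split=> [l'|_]; first exact: low.
  by rewrite !delta_dot al bl.
case: (F2_case (a 0 i)) => ai.
  exists (delta_mx i 0); split=> [l'|_]; first exact: low.
  by move: ci; rewrite !delta_dot ai add0r => ->.
exists (delta_mx l 0 + delta_mx i 0); split=> [l' l'q|_].
  by rewrite mxE !low // addr0.
have bi : b 0 i = 0.
  by case: (F2_case (b 0 i)) ci => // ->; rewrite ai F2_addxx.
by rewrite !mulmxDr !delta_dot al ai bl bi z0 addr0 rV2_addxx.
Qed.

Section net_rows.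
Variables (s m : nat) (C : gen_matrices s m) (t : nat).
Hypotheses (s0 : (0 < s)%N) (netC : is_net C t).

Lemma net_t_le : (t <= m)%N.
Proof. by case/andP: netC. Qed.

(** The defining property of a net, with rows of C_j that may add up to less
    than m - t, and linear dependence written with a vector for each block. *)
Lemma net_rows_free (q : 'I_s -> nat) (u : 'I_s -> 'rV['F_2]_m) :
  (\sum_j q j <= m - t)%N ->
  (forall j (c : 'I_m), (q j <= c)%N -> u j 0 c = 0) ->
  \sum_j u j *m C j = 0 -> forall j, u j = 0.
Proof.
move=> q_le u0 uC; case/andP: netC => tm /forallP frees.
pose j0 := Ordinal s0.
(* The missing rows are all taken from the first block. *)
pose q1 j : nat := (q j + (if j == j0 then m - t - \sum_j q j else 0))%N.
have q1_sum : (\sum_j q1 j = m - t)%N.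
  by rewrite big_split /= -big_mkcond /= big_pred1_eq subnKC.
have q1_lt j : (q1 j < m.+1)%N.
  have : (q1 j <= \sum_j q1 j)%N by rewrite (bigD1 j) //= leq_addr.
  by rewrite q1_sum; lia.
pose Q : {ffun 'I_s -> 'I_m.+1} := [ffun j => Ordinal (q1_lt j)].
have QE j : Q j = q1 j :> nat by rewrite ffunE.
have Q_sum : (\sum_j Q j == m - t)%N.
  by rewrite (eq_bigr q1) ?q1_sum // => j _; exact: QE.
have /row_free_inj inj := implyP (frees Q) Q_sum.
pose W j : 'I_(Q j) -> 'I_m := widen_ord (leq_ord (Q j)).
pose v := \mxrow_(j < s) colsub (W j) (u j).
have uE j : colsub (W j) (u j) *m rowsub (W j) (C j) = u j *m C j.
  apply/matrixP => i c; rewrite !mxE ord1 {i}.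
  rewrite [RHS](bigID (fun l : 'I_m => (l < Q j)%N)) /= [X in _ + X]big1 ?addr0.
    under eq_bigr do rewrite !mxE.
    rewrite (big_ord_narrow (leq_ord (Q j))).
    by apply: eq_bigr.
  move=> l; rewrite -leqNgt QE => ql; rewrite u0 ?mul0r //.
  by apply: leq_trans ql; rewrite leq_addr.
have v0 : v = 0.
  apply: inj; rewrite mul0mx mul_mxrow_mxcol -[RHS]uC.
  by apply: eq_bigr => j _.
move=> j; apply/rowP => c; rewrite [RHS]mxE.
have [cq|qc] := ltnP c (Q j); last first.
  by apply: u0; apply: leq_trans qc; rewrite QE leq_addr.
have /(congr1 (fun A : 'rV_(Q j) => A 0 (Ordinal cq))) : colsub (W j) (u j) = 0.
  by have := mxrowK (fun j => colsub (W j) (u j)) j; rewrite -/v v0 => <-; rewrite submxrow0.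
rewrite !mxE => <-; congr (u j _ _); exact: val_inj.
Qed.


Section scrambled_rows.
Variable L : nat.
Implicit Types (k : {ffun 'I_s -> 'rV['F_2]_L}).
Implicit Types (M E : {ffun 'I_s -> 'M['F_2]_(L, m)}).

(** The vector whose vanishing is the event attached to the frequency k. *)
Definition zvec k M : 'rV['F_2]_m := \sum_j k j *m M j *m C j.

Lemma zvecDr k M E : zvec k (M + E) = zvec k M + zvec k E.
Proof.
rewrite -big_split; apply: eq_bigr => j _.
by rewrite ffunE mulmxDr mulmxDl.
Qed.

Lemma zvecDl k1 k2 M : zvec (k1 + k2) M = zvec k1 M + zvec k2 M.
Proof.
rewrite -big_split; apply: eq_bigr => j _.
by rewrite ffunE !mulmxDl.
Qed.

Definition unit_lower M : Prop := forall j (l : 'I_L) (c : 'I_m),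
  ((l : nat) = c -> M j l c = 1) /\ ((l < c)%N -> M j l c = 0).

Definition strict_lower E : Prop := forall j (l : 'I_L) (c : 'I_m),
  (l <= c)%N -> E j l c = 0.

Definition tops k : nat := (\sum_j top (k j))%N.

(** Scrambling does not move the top digits, so that a frequency in the
    annihilator of the scrambled net has large total degree. *)
Lemma zvec_neq0 k M : unit_lower M -> k != 0 -> zvec k M = 0 ->
  (m - t < tops k)%N.
Proof.
move=> uM k0 kM; rewrite ltnNge; apply/negP => tk.
have supp j (c : 'I_m) : (top (k j) <= c)%N -> (k j *m M j) 0 c = 0.
  move=> tc; rewrite mxE big1 // => l _.
  have [->|kl] := eqVneq (k j 0 l) 0; first by rewrite mul0r.
  rewrite (proj2 (uM j l c)) ?mulr0 //.
  exact: leq_trans (leq_top kl) tc.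
have kM0 := net_rows_free tk supp kM.
move/eqP: k0; apply; apply/ffunP => j; rewrite ffunE; apply/eqP.
rewrite -top_eq0; apply/negPn/negP; rewrite -lt0n => tj.
have [l kl tl] := top_attained tj.
have lm : (l < m)%N.
  have : (top (k j) <= tops k)%N by rewrite /tops (bigD1 j) //= leq_addr.
  by rewrite tl => h; have := leq_trans h tk; lia.
have /(congr1 (fun A : 'rV_m => A 0 (Ordinal lm))) := kM0 j.
rewrite !mxE (bigD1 l) //= (proj1 (uM j l (Ordinal lm))) // mulr1 big1 ?addr0.
  by move=> /eqP; apply/negP.
move=> i il; have [->|ki] := eqVneq (k j 0 i) 0; first by rewrite mul0r.
rewrite (proj2 (uM j i (Ordinal lm))) ?mulr0 //=.
have := leq_top ki; rewrite tl ltnS leq_eqVlt => /orP[/eqP e|//].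
by move/eqP: il; case; apply: val_inj.
Qed.

Definition low_vec (q : 'I_s -> nat) : {set {ffun 'I_s -> 'rV['F_2]_m}} :=
  [set u : {ffun 'I_s -> 'rV['F_2]_m} |
    [forall j, forall c : 'I_m, (q j <= c)%N ==> (u j 0 c == 0)]].

Lemma low_vecP (q : 'I_s -> nat) (u : {ffun 'I_s -> 'rV['F_2]_m}) :
  reflect (forall j (c : 'I_m), (q j <= c)%N -> u j 0 c = 0) (u \in low_vec q).
Proof.
rewrite inE; apply: (iffP forallP) => [h j c qc|h j].
  by apply/eqP; exact: (implyP (forallP (h j) c)).
by apply/forallP => c; apply/implyP => qc; apply/eqP; exact: h.
Qed.

Lemma low_vecB (q : 'I_s -> nat) u v :
  u \in low_vec q -> v \in low_vec q -> u - v \in low_vec q.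
Proof.
move=> /low_vecP hu /low_vecP hv; apply/low_vecP => j c qc.
by rewrite !ffunE !mxE hu // hv // subr0.
Qed.

Lemma card_low_vec (q : 'I_s -> nat) : (forall j, q j <= m)%N ->
  (2 ^ (\sum_j q j) <= #|low_vec q|)%N.
Proof.
move=> qm; pose F j : {set 'rV['F_2]_m} :=
  [set v : 'rV_m | [forall c : 'I_m, (q j <= c)%N ==> (v 0 c == 0)]].
have -> : low_vec q = [set u in family F].
  apply/setP => u; rewrite !inE; apply/forallP/familyP => h j; have := h j.
    by rewrite inE.
  by rewrite inE.
rewrite cardsE card_family foldrE big_map big_enum /= expn_sum.
apply: leq_prod => j _.
have -> : (2 ^ q j)%N = #|{: 'rV['F_2]_(q j)}| by rewrite card_mx mul1n card_ord.
pose g (v : 'rV['F_2]_(q j)) : 'rV['F_2]_m :=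
  \row_c oapp (v 0) 0 (insub (c : nat) : option 'I_(q j)).
have ginj : injective g.
  move=> v w vw; apply/rowP => i.
  have := congr1 (fun A : 'rV_m => A 0 (widen_ord (qm j) i)) vw.
  rewrite !mxE /= (_ : insub (i : nat) = Some i) //; exact: valK.
rewrite -(card_imset _ ginj); apply: subset_leq_card; apply/fintype.subsetP => v.
case/imsetP => w _ ->; rewrite inE; apply/forallP => c; apply/implyP => qc.
by rewrite mxE insubN //= -leqNgt.
Qed.

Definition invariant_law (R : realFieldType)
    (mu : {ffun 'I_s -> 'M['F_2]_(L, m)} -> R) : Prop :=
  [/\ forall M, 0 <= mu M, \sum_M mu M = 1 &
      forall M E, strict_lower E -> mu (M + E) = mu M].

(** The translates have equal measure by invariance of the law and, being
    disjoint, total measure at most 1. *)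
Lemma disjoint_translates (R : realFieldType) mu (I : finType) (U : {set I})
    (A : pred {ffun 'I_s -> 'M['F_2]_(L, m)})
    (E : I -> {ffun 'I_s -> 'M['F_2]_(L, m)}) :
  @invariant_law R mu ->
  (forall i, i \in U -> strict_lower (E i)) ->
  (forall i i' M, i \in U -> i' \in U -> A (M + E i) -> A (M + E i') -> i = i') ->
  (\sum_(M | A M) mu M) * #|U|%:R <= 1.
Proof.
move=> [mu0 mu1 muE] lowE disj.
have -> : (\sum_(M | A M) mu M) * #|U|%:R =
    \sum_(i in U) \sum_(M : {ffun 'I_s -> 'M['F_2]_(L, m)} | A (M + E i)) mu M.
  rewrite mulr_natr -sumr_const; apply: eq_bigr => i iU.
  have shift_inj : injective
    (fun M : {ffun 'I_s -> 'M['F_2]_(L, m)} => M + E i) by exact: addIr.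
  rewrite (reindex_inj shift_inj); apply: eq_bigr => M _.
  by rewrite muE //; exact: lowE.
rewrite (exchange_big_dep xpredT) //= -mu1; apply: ler_sum => M _.
rewrite sumr_const -[_ *+ _]mulr_natr ler_piMr // -[1]/(1%:R) ler_nat.
apply/card_le1P => i; rewrite -topredE /= => /andP[iU Ai] i'.
rewrite -topredE /=; apply/idP/eqP => [/andP[i'U Ai']|->]; last by rewrite iU.
exact: disj i'U iU Ai' Ai.
Qed.

(** Rank-one perturbations of the matrices change the two vectors attached to
    k1 and k2 independently of each other. *)
Lemma joint_zvec_bound (R : realFieldType) mu
    (k1 k2 : {ffun 'I_s -> 'rV['F_2]_L}) (q1 q2 : 'I_s -> nat) :
  @invariant_law R mu ->
  (forall j, q1 j <= (top (k1 j)).-1)%N ->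
  (forall j, q2 j <= (minn (top (k2 j)) (top (k1 j + k2 j)%R)).-1)%N ->
  (\sum_j q1 j <= m - t)%N -> (\sum_j q2 j <= m - t)%N ->
  (\sum_(M | (zvec k1 M == 0) && (zvec k2 M == 0)) mu M) *
    2 ^+ (\sum_j q1 j + \sum_j q2 j) <= 1.
Proof.
move=> law h1 h2 s1 s2.
have qm (q : 'I_s -> nat) j : (\sum_j q j <= m - t)%N -> (q j <= m)%N.
  by rewrite (bigD1 j) //=; lia.
have /fin_all_exists[p1 p1P] j := top_dual (h1 j).
have /fin_all_exists[p2 p2P] j := top_dual_pair (h2 j).
(* The rows of w.1 act on k1 through p1, those of w.2 act on k2 through p2,
   which is orthogonal to k1. *)
pose E (w : {ffun 'I_s -> 'rV['F_2]_m} * {ffun 'I_s -> 'rV['F_2]_m}) :=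
  [ffun j => p1 j *m w.1 j + p2 j *m w.2 j] : {ffun 'I_s -> 'M['F_2]_(L, m)}.
have EB w w' : E w - E w' = E (w.1 - w'.1, w.2 - w'.2).
  apply/ffunP => j; rewrite !ffunE /= !mulmxBr; rewrite opprD !addrA.
  by congr (_ + _); rewrite addrAC.
pose U := finset.setX (low_vec q1) (low_vec q2).
have inU w : (w \in U) = (w.1 \in low_vec q1) && (w.2 \in low_vec q2).
  by case: w => u v; rewrite finset.in_setX.
have low0 (q : 'I_s -> nat) u j : u \in low_vec q -> q j = 0%N -> u j = 0.
  by move=> /low_vecP h q0; apply/rowP => c; rewrite mxE h // q0.
have zE1 w : w \in U -> zvec k1 (E w) = \sum_j w.1 j *m C j.
  case: w => u v; rewrite inE => /andP[/= uq vq]; apply: eq_bigr => j _.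
  rewrite ffunE /= mulmxDr !mulmxA.
  have -> : k1 j *m p1 j *m u j = u j.
    have [q0|q0] := posnP (q1 j); first by rewrite (low0 _ _ _ uq q0) mulmx0.
    by rewrite (proj2 (p1P j)) // mul1mx.
  have -> : k1 j *m p2 j *m v j = 0.
    have [q0|q0] := posnP (q2 j); first by rewrite (low0 _ _ _ vq q0) mulmx0.
    by have [-> _] := proj2 (p2P j) q0; rewrite mul0mx.
  by rewrite addr0.
have zE2 w : w \in U -> w.1 = 0 -> zvec k2 (E w) = \sum_j w.2 j *m C j.
  case: w => u v; rewrite inE => /andP[/= uq vq] ->; apply: eq_bigr => j _.
  rewrite !ffunE /= mulmx0 add0r !mulmxA.
  have [q0|q0] := posnP (q2 j); first by rewrite (low0 _ _ _ vq q0) !mulmx0.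
  by have [_ ->] := proj2 (p2P j) q0; rewrite mul1mx.
have cU : (2 ^ (\sum_j q1 j + \sum_j q2 j) <= #|U|)%N.
  by rewrite cardsX expnD leq_mul // card_low_vec // => j; exact: qm.
apply: le_trans (@disjoint_translates _ mu _ U
  (fun M => (zvec k1 M == 0) && (zvec k2 M == 0)) E law _ _).
- rewrite -natrX ler_wpM2l ?ler_nat // sumr_ge0 // => M _.
  by case: law => mu0 _ _; exact: mu0.
- move=> [u v]; rewrite inE => /andP[/= uq vq] j l c lc; rewrite ffunE !mxE.
  rewrite !big_ord1.
  have [lq|ql] := ltnP l (q1 j); last first.
    rewrite [u j 0 c](low_vecP _ _ uq) ?mulr0 ?add0r; last exact: leq_trans lc.
    have [lq|ql'] := ltnP l (q2 j); first by rewrite (proj1 (p2P j)) ?mul0r.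
    by rewrite [v j 0 c](low_vecP _ _ vq) ?mulr0 //; exact: leq_trans lc.
  rewrite (proj1 (p1P j)) // mul0r add0r.
  have [lq'|ql'] := ltnP l (q2 j); first by rewrite (proj1 (p2P j)) ?mul0r.
  by rewrite [v j 0 c](low_vecP _ _ vq) ?mulr0 //; exact: leq_trans lc.
- move=> w w' M wU w'U /andP[/eqP a1 /eqP a2] /andP[/eqP b1 /eqP b2].
  have dU : (w.1 - w'.1, w.2 - w'.2) \in U.
    move: wU w'U; rewrite !inU /= => /andP[? ?] /andP[? ?].
    by rewrite !low_vecB.
  have dE (k : {ffun 'I_s -> 'rV['F_2]_L}) : zvec k (M + E w) = 0 ->
      zvec k (M + E w') = 0 -> zvec k (E (w.1 - w'.1, w.2 - w'.2)) = 0.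
    move=> e1 e2; rewrite -EB; apply: (addrI (zvec k (M + E w'))).
    by rewrite -zvecDr addr0 addrACA subrr addr0 ?e1 ?e2.
  have d1 := dE _ a1 b1; have d2 := dE _ a2 b2.
  have free (q : 'I_s -> nat) (x : {ffun 'I_s -> 'rV['F_2]_m}) :
      (\sum_j q j <= m - t)%N -> x \in low_vec q ->
      \sum_j x j *m C j = 0 -> x = 0.
    move=> qs /low_vecP xq x0; apply/ffunP => j; rewrite ffunE.
    exact: (net_rows_free qs xq x0).
  have w1 : w.1 - w'.1 = 0.
    apply: (free _ _ s1); first by move: dU; rewrite inU => /andP[].
    by rewrite -(zE1 _ dU).
  have w2 : w.2 - w'.2 = 0.
    apply: (free _ _ s2); first by move: dU; rewrite inU => /andP[].
    by rewrite -(zE2 _ dU).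
  case: w w' w1 w2 {wU w'U a1 a2 b1 b2 dU dE d1 d2} => [u v] [u' v'] /=.
  by move=> /subr0_eq -> /subr0_eq ->.
Qed.

End scrambled_rows.
End net_rows.

(** * Exponents and sums over pairs of frequencies *)

Lemma sub_sum_attained (I : finType) (b : I -> nat) (N : nat) :
  (N <= \sum_i b i)%N ->
  exists q : I -> nat, (forall i, q i <= b i)%N /\ (\sum_i q i = N)%N.
Proof.
move=> Nb; have [d] : exists d, (N + d = \sum_i b i)%N.
  by exists (\sum_i b i - N)%N; rewrite subnKC.
elim: d N {Nb} => [|d IH] N; first by rewrite addn0 => ->; exists b.
rewrite -addSnnS => /IH[q [qb qN]].
case: (pickP (fun i => 0 < q i)%N) => [i qi|q0]; last first.
  by move: qN; rewrite big1 // => i _; have := q0 i; case: (q i).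
exists (fun j => q j - (j == i))%N; split=> [j|].
  by apply: leq_trans (qb j); rewrite leq_subr.
move: qN; rewrite (bigD1 i) //= => qN; rewrite (bigD1 i) //= eqxx.
rewrite (eq_bigr q) => [|j /negbTE ->]; last by rewrite subn0.
by lia.
Qed.

Section degrees.
Variables s L : nat.
Implicit Types k : {ffun 'I_s -> 'rV['F_2]_L}.

Definition joint_degree k1 k2 : nat :=
  (\sum_j joint (k1 j) (k2 j) (k1 j + k2 j)%R)%N.

(** The part of the joint degree that is not the degree of k1 + k2. *)
Definition rest_degree k1 k2 : nat :=
  (\sum_j minn (top (k1 j)) (top (k2 j)))%N.

Lemma joint_split (a b c : 'rV['F_2]_L) : a + b + c = 0 ->
  [/\ joint a b c = (top a + minn (top b) (top c))%N,
      joint a b c = (top b + minn (top a) (top c))%N,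
      joint a b c = (top c + minn (top a) (top b))%N &
      (top a + top b + top c <= 2 * joint a b c)%N].
Proof.
move=> abc; rewrite /joint.
have sec_le (k : 'rV['F_2]_L) : (second k <= top k)%N := second_le_top k.
have := sec_le a; have := sec_le b; have := sec_le c.
by case: (top_triple abc) => -[]; split; lia.
Qed.

Lemma joint_degreeE k1 k2 :
  [/\ joint_degree k1 k2 = (tops k1 + rest_degree k2 (k1 + k2)%R)%N,
      joint_degree k1 k2 = (tops k2 + rest_degree k1 (k1 + k2)%R)%N,
      joint_degree k1 k2 = (tops (k1 + k2)%R + rest_degree k1 k2)%N &
      (tops k1 + tops k2 + tops (k1 + k2)%R <= 2 * joint_degree k1 k2)%N].
Proof.
have h j := joint_split (rV2_addxx (k1 j + k2 j)).
split; rewrite ?big_distrr -!big_split /=.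
- by apply: eq_bigr => j _; rewrite ffunE; have [] := h j.
- by apply: eq_bigr => j _; rewrite ffunE; have [] := h j.
- by apply: eq_bigr => j _; rewrite ffunE; have [] := h j.
- by rewrite leq_sum // => j _; rewrite ffunE; have [] := h j.
Qed.


End degrees.

Lemma joint_pair_le L (a b c : 'rV['F_2]_L) : a + b + c = 0 ->
  (2 <= (top a + top b <= joint a b c) + (top a + top c <= joint a b c) +
        (top b + top c <= joint a b c))%N.
Proof.
move=> abc; have sec_le (k : 'rV['F_2]_L) : (second k <= top k)%N.
  exact: second_le_top.
have := sec_le a; have := sec_le b; have := sec_le c.
rewrite /joint => hc hb ha.
case: (leqP (top a + top b)); case: (leqP (top a + top c));
  case: (leqP (top b + top c)) => // h1 h2 h3; case: (top_triple abc) => -[]; lia.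
Qed.

(** In each coordinate the two largest top digits are held by one pair among
    k1, k2 and k1 + k2; with at most two coordinates, some pair never holds
    them. *)
Lemma joint_degree_le2 s L (k1 k2 : {ffun 'I_s -> 'rV['F_2]_L}) : (s <= 2)%N ->
  [\/ tops k1 + tops k2 <= joint_degree k1 k2,
      tops k1 + tops (k1 + k2)%R <= joint_degree k1 k2 |
      tops k2 + tops (k1 + k2)%R <= joint_degree k1 k2]%N.
Proof.
have h j := joint_pair_le (rV2_addxx (k1 j + k2 j)).
have addE j : (k1 + k2) j = k1 j + k2 j by rewrite ffunE.
rewrite /tops /joint_degree.
move: k1 k2 h addE; case: s => [|[|[|s]]] // k1 k2 h addE _.
- by rewrite !big_ord0; apply: Or31.
- move: (h ord0); rewrite !big_ord1 addE.
  set a1 := (_ + _ <= _)%N; set b1 := (_ + _ <= _)%N; set c1 := (_ + _ <= _)%N.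
  have [A|A] := boolP a1; first by move=> _; apply: Or31.
  have [B|B] := boolP b1; first by move=> _; apply: Or32.
  by case: c1.
- move: (h ord0) (h (lift ord0 ord0)).
  rewrite !big_ord_recl !big_ord0 !addE !addn0.
  set a1 := (_ + _ <= _)%N; set b1 := (_ + _ <= _)%N; set c1 := (_ + _ <= _)%N.
  set a2 := (_ + _ <= _)%N; set b2 := (_ + _ <= _)%N; set c2 := (_ + _ <= _)%N.
  move=> h1 h2.
  have [/andP[]|/andP[]|/andP[]] : [\/ a1 && a2, b1 && b2 | c1 && c2].
    by apply/or3P; move: h1 h2; clearbody a1 b1 c1 a2 b2 c2;
      move: a1 b1 c1 a2 b2 c2 => [] [] [] [] [] [].
  + by rewrite /a1 /a2 => ? ?; apply: Or31; rewrite addnACA leq_add.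
  + by rewrite /b1 /b2 => ? ?; apply: Or32; rewrite addnACA leq_add.
  + by rewrite /c1 /c2 => ? ?; apply: Or33; rewrite addnACA leq_add.
Qed.

(** Here n_i are the total degrees of k1, k2 and k1 + k2, Q_i the complementary
    degrees, and d_i the three lower bounds for the rank. If some d_i is nearly
    2m, so is D; otherwise adding up the three bounds gives the exponent 9/2. *)
Lemma nine_halves (x t s m D n1 n2 n3 Q1 Q2 Q3 d1 d2 d3 : nat) :
  (x < n1 -> x < n2 -> x < n3 ->
  D = n1 + Q1 -> D = n2 + Q2 -> D = n3 + Q3 -> n1 + n2 + n3 <= 2 * D ->
  m = x + t ->
  x + Q1 <= d1 + s + s \/ 2 * x <= d1 + s /\ x <= Q1 ->
  x + Q2 <= d2 + s + s \/ 2 * x <= d2 + s /\ x <= Q2 ->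
  x + Q3 <= d3 + s + s \/ 2 * x <= d3 + s /\ x <= Q3 ->
  9 * m <= 2 * d1 + 4 * D + 12 * (t + s) \/
  9 * m <= 2 * d2 + 4 * D + 12 * (t + s) \/
  9 * m <= 2 * d3 + 4 * D + 12 * (t + s))%N.
Proof.
move=> b1 b2 b3 E1 E2 E3 EN Em [l1|[l1 q1]]; last first.
  by left; clear -b1 E1 Em l1 q1; lia.
case=> [l2|[l2 q2]]; last by right; left; clear -b2 E2 Em l2 q2; lia.
case=> [l3|[l3 q3]]; last by right; right; clear -b3 E3 Em l3 q3; lia.
have : (27 * m <= 2 * (d1 + d2 + d3) + 12 * D + 36 * (t + s))%N by lia.
have [h1|h1] := leqP (9 * m)%N (2 * d1 + 4 * D + 12 * (t + s))%N; first by left.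
have [h2|h2] := leqP (9 * m)%N (2 * d2 + 4 * D + 12 * (t + s))%N.
  by right; left.
by move=> h; right; right; clear -h1 h2 h; lia.
Qed.

Section probability_bounds.
Variables (R : realFieldType) (s m L : nat) (C : gen_matrices s m) (t : nat).
Variable mu : {ffun 'I_s -> 'M['F_2]_(L, m)} -> R.
Hypotheses (s0 : (0 < s)%N) (netC : is_net C t).
Hypotheses (law : invariant_law mu).
Hypothesis supp : forall M, mu M != 0 -> unit_lower M.
Implicit Types k : {ffun 'I_s -> 'rV['F_2]_L}.

Definition pair_prob k1 k2 : R :=
  \sum_(M | (zvec C k1 M == 0) && (zvec C k2 M == 0)) mu M.

Lemma pair_prob_ge0 k1 k2 : 0 <= pair_prob k1 k2.
Proof. by case: law => mu0 _ _; rewrite sumr_ge0. Qed.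

Lemma pair_prob_sym k1 k2 : pair_prob k1 k2 = pair_prob k2 k1.
Proof. by apply: eq_bigl => M; rewrite andbC. Qed.

Lemma pair_prob_add k1 k2 : pair_prob k1 k2 = pair_prob k1 (k1 + k2).
Proof.
apply: eq_bigl => M; rewrite zvecDl; case: eqP => //= ->.
by rewrite add0r.
Qed.

Lemma pair_prob_le1 k1 k2 : pair_prob k1 k2 <= 1.
Proof.
case: law => mu0 <- _; rewrite [leRHS](bigID (fun M => (zvec C k1 M == 0) && (zvec C k2 M == 0))) /=.
by rewrite lerDl sumr_ge0.
Qed.

(** A lower bound for the number of independent linear conditions: those on
    the first frequency come from its own leading digits, those on the second
    one from the digits that separate it from the first. *)
Let pair_rank k1 k2 : nat :=
  (minn (m - t) (tops k1 - s) + minn (m - t) (rest_degree k2 (k1 + k2)%R - s))%N.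

Let pair_prob_rank k1 k2 : pair_prob k1 k2 * 2 ^+ pair_rank k1 k2 <= 1.
Proof.
pose b1 j := (top (k1 j)).-1.
pose b2 j := (minn (top (k2 j)) (top (k1 j + k2 j)%R)).-1.
have pred_sum (b : 'I_s -> nat) : (\sum_j b j - s <= \sum_j (b j).-1)%N.
  rewrite leq_subLR -[s in (s + _)%N]card_ord -sum1_card -big_split /=.
  by apply: leq_sum => j _; lia.
have [|q1 [q1b q1E]] := @sub_sum_attained _ b1 (minn (m - t) (tops k1 - s)).
  by apply: leq_trans (geq_minr _ _) _; apply: pred_sum.
have [|q2 [q2b q2E]] := @sub_sum_attained _ b2
    (minn (m - t) (rest_degree k2 (k1 + k2)%R - s)).
  apply: leq_trans (geq_minr _ _) _; apply: leq_trans (pred_sum _).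
  by rewrite leq_sub2r // leq_sum // => j _; rewrite ffunE.
have := joint_zvec_bound s0 netC law q1b q2b.
by rewrite q1E q2E !geq_minl => /(_ isT isT).
Qed.

Let pair_prob_neq0 k1 k2 : k1 != 0 -> k2 != 0 -> k1 != k2 ->
  pair_prob k1 k2 != 0 ->
  [/\ m - t < tops k1, m - t < tops k2 & m - t < tops (k1 + k2)%R]%N.
Proof.
move=> k10 k20 k12 p0.
have [M /andP[/andP[/eqP z1 /eqP z2] muM]] : exists M,
    (zvec C k1 M == 0) && (zvec C k2 M == 0) && (mu M != 0).
  apply/existsP; apply: contraNT p0 => /existsPn noM; apply/eqP/big1 => M Z.
  by apply/eqP; have := noM M; rewrite Z /= negbK.
have uM := supp muM.
have k3 : k1 + k2 != 0.
  apply: contraNneq k12 => /ffunP k3; apply/eqP/ffunP => j.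
  have := k3 j; rewrite !ffunE => e.
  by rewrite -[k1 j]addr0 -(rV2_addxx (k2 j)) addrA e add0r.
by split; apply: (zvec_neq0 s0 netC uM) => //; rewrite zvecDl z1 z2 addr0.
Qed.

(** The rank bound holds for the three ways of singling out a frequency among
    k1, k2 and k1 + k2, all of which define the same event. *)
Lemma pair_prob_general k1 k2 : k1 != 0 -> k2 != 0 -> k1 != k2 ->
  pair_prob k1 k2 != 0 -> exists2 r : nat,
  pair_prob k1 k2 * 2 ^+ r <= 1 &
  (9 * m <= 2 * r + 4 * joint_degree k1 k2 + 12 * (t + s))%N.
Proof.
move=> k10 k20 k12 p0; have [n1 n2 n3] := pair_prob_neq0 k10 k20 k12 p0.
have [D1 D2 D3 DN] := joint_degreeE k1 k2.
have r1 := pair_prob_rank k1 k2.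
have r2 := pair_prob_rank k2 k1.
have r3 := pair_prob_rank (k1 + k2) k1.
have k12K : k1 + k2 + k1 = k2.
  by apply/ffunP => j; rewrite !ffunE addrAC rV2_addxx add0r.
have tm := net_t_le netC.
rewrite pair_prob_sym /pair_rank [k2 + k1]addrC in r2.
rewrite pair_prob_sym -pair_prob_add /pair_rank k12K in r3.
rewrite /pair_rank in r1.
have low_rank n Q : (m - t < n)%N ->
    let r := (minn (m - t) (n - s) + minn (m - t) (Q - s))%N in
    (m - t + Q <= r + s + s)%N \/
    (2 * (m - t) <= r + s)%N /\ (m - t <= Q)%N.
  move=> nb r; have [h|h] := leqP (m - t)%N (Q - s)%N; [right|left]; lia.
have [h|[h|h]] : (9 * m <= 2 * pair_rank k1 k2 + 4 * joint_degree k1 k2 + 12 * (t + s))%N \/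
  (9 * m <= 2 * pair_rank k2 k1 + 4 * joint_degree k1 k2 + 12 * (t + s))%N \/
  (9 * m <= 2 * pair_rank (k1 + k2)%R k1 + 4 * joint_degree k1 k2 + 12 * (t + s))%N.
  rewrite /pair_rank [k2 + k1]addrC k12K.
  apply: (@nine_halves (m - t) t s m _ _ _ _ _ _ _ _ _ _ n1 n2 n3 D1 D2 D3 DN);
    by [rewrite subnK | exact: low_rank].
- by exists (pair_rank k1 k2).
- by exists (pair_rank k2 k1) => //; rewrite pair_prob_sym /pair_rank addrC in r2 *.
- by exists (pair_rank (k1 + k2) k1) => //; rewrite /pair_rank k12K.
Qed.

(** With at most two coordinates the joint degree exceeds 2(m - t), and the
    marginal rank bound m - t is enough. *)
Lemma pair_prob_le2 k1 k2 : (s <= 2)%N -> k1 != 0 -> k2 != 0 -> k1 != k2 ->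
  pair_prob k1 k2 != 0 -> exists2 r : nat,
  pair_prob k1 k2 * 2 ^+ r <= 1 &
  (5 * m <= r + 2 * joint_degree k1 k2 + 6 * (t + s))%N.
Proof.
move=> s2 k10 k20 k12 p0; have [n1 n2 n3] := pair_prob_neq0 k10 k20 k12 p0.
have tm := net_t_le netC.
have D2 : (2 * (m - t) <= joint_degree k1 k2)%N.
  by case: (joint_degree_le2 k1 k2 s2) => h; move: n1 n2 n3 h; clear; lia.
exists (pair_rank k1 k2); first exact: pair_prob_rank.
have : (m - t <= pair_rank k1 k2 + s)%N.
  by rewrite /pair_rank -leq_subLR; move: n1; clear; lia.
by move: D2 tm; clear; lia.
Qed.

Lemma joint_degree_ge k1 k2 : k1 != 0 -> k2 != 0 -> k1 != k2 ->
  pair_prob k1 k2 != 0 -> (3 * m <= 2 * joint_degree k1 k2 + 3 * t)%N.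
Proof.
move=> k10 k20 k12 p0; have [n1 n2 n3] := pair_prob_neq0 k10 k20 k12 p0.
have [_ _ _] := joint_degreeE k1 k2.
by have := net_t_le netC; lia.
Qed.

End probability_bounds.

(** Geometric damping by 2^(-delta) per unit of the joint degree costs only a
    multiple of delta in the exponent: it is harmless as long as the degree is
    at most 4m, and beyond that the factor 4^D alone is large enough. *)
Lemma damped_bound (R : realType) (p e delta rho m : R) (D : nat) :
  0 <= m -> 0 <= e -> 0 <= delta <= 1 / 2 -> rho <= 6 ->
  (rho + 4 * delta) * m <= e + 2 * D%:R ->
  p <= 2 `^ (- e) ->
  p <= 2 `^ (- (rho * m)) * (4 * 2 `^ (- delta)) ^+ D.
Proof.
move=> m0 e0 /andP[d0 d1] rho6 he hp; apply: le_trans hp _.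
have -> : 4 * 2 `^ (- delta) = 2 `^ (2 - delta) :> R.
  rewrite powRD; last by apply/implyP; rewrite pnatr_eq0.
  by congr (_ * _); rewrite (powR_mulrn 2) // -natrX.
rewrite -powR_mulrn ?powR_ge0 // -powRrM -powRD; last first.
  by apply/implyP; rewrite pnatr_eq0.
rewrite ler_powR ?ler1n //.
have D0 : 0 <= D%:R :> R by [].
have [Dm|mD] := lerP D%:R (4 * m); nra.
Qed.

Section weight_sum.
Variables (R : realFieldType) (s L : nat).
Implicit Types k : {ffun 'I_s -> 'rV['F_2]_L}.

Definition weights k : R := \prod_j weight R (k j).

Lemma weights_ge0 k : 0 <= weights k.
Proof. by apply: prodr_ge0 => j _; exact: weight_ge0. Qed.

Lemma sum_weights beta : 0 <= beta < 1 ->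
  \sum_k1 \sum_k2 weights k1 * weights k2 * weights (k1 + k2) *
    (4 * beta) ^+ joint_degree k1 k2 <= (3 * ((1 - beta) ^+ 2)^-1 ^+ 2) ^+ s.
Proof.
move=> b01; have b0 : 0 <= beta by case/andP: b01.
pose F (a b : 'rV['F_2]_L) :=
  weight R a * weight R b * weight R (a + b) * (4 * beta) ^+ joint a b (a + b).
have F0 a b : 0 <= F a b.
  by rewrite !mulr_ge0 ?weight_ge0 ?exprn_ge0 ?mulr_ge0.
have -> : \sum_k1 \sum_k2 weights k1 * weights k2 * weights (k1 + k2) *
    (4 * beta) ^+ joint_degree k1 k2 = \prod_(j < s) \sum_a \sum_b F a b.
  rewrite bigA_distr_bigA /=; apply: eq_bigr => k1 _.
  rewrite bigA_distr_bigA /=; apply: eq_bigr => k2 _.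
  rewrite /weights /joint_degree -prodrXr -!big_split /=.
  by apply: eq_bigr => j _; rewrite /F ffunE.
rewrite -[s in leRHS]card_ord -prodr_const ler_prod // => j _.
rewrite sum_weight_triple // andbT.
by apply: sumr_ge0 => a _; apply: sumr_ge0 => b _.
Qed.

End weight_sum.

Local Open Scope classical_set_scope.
Local Open Scope ring_scope.

(** * Finite differences *)

Section finite_differences.
Variables (R : realType) (s : nat).
Implicit Types (f g : 'rV[R]_s -> R) (x y : 'rV[R]_s) (j : 'I_s).

Lemma cube_segment j x (a b c : R) : a <= b <= c ->
  cube (x + a *: delta_mx 0 j) -> cube (x + c *: delta_mx 0 j) ->
  cube (x + b *: delta_mx 0 j).
Proof.
move=> /andP[ab bc] ca cc i; have := ca i; have := cc i; rewrite !mxE eqxx /=.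
by case: (i == j); rewrite /= ?mulr1 ?mulr0; lra.
Qed.

(** The filter of increments that stay in the cube, in terms of distances. *)
Lemma pderivable_eps j g x : pderivable j g x -> forall eps : R, 0 < eps ->
  exists2 del : R, 0 < del & forall h : R, h != 0 -> `|h| < del ->
    cube (x + h *: delta_mx 0 j) ->
    `|diff_quotient j g x h - pderiv j g x| < eps.
Proof.
rewrite /pderivable => gl eps e0.
have gl' : diff_quotient j g x @ pd_filter j x --> pderiv j g x by [].
move/cvgrPdist_lt : gl' => /(_ _ e0)/nbhs_ballP[del /= d0 hdel].
exists del => // h h0 hd ch; rewrite distrC.
by apply: hdel => //; rewrite /ball /= sub0r normrN.
Qed.

Definition line f y j : R -> R := fun tau => f (y + tau *: delta_mx 0 j).

Lemma line_add f y j (tau h : R) :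
  line f y j (tau + h) = f (y + tau *: delta_mx 0 j + h *: delta_mx 0 j).
Proof. by rewrite /line scalerDl addrA. Qed.

Lemma line_continuous f y j (h : R) :
  cube y -> cube (y + h *: delta_mx 0 j) ->
  (forall x, cube x -> pderivable j f x) ->
  {within `[0, h], continuous (line f y j)}.
Proof.
move=> cy ch pf; apply/subspace_continuousP => tau /=; rewrite in_itv /= => t01.
have cyt (t : R) : 0 <= t <= h -> cube (y + t *: delta_mx 0 j).
  by move=> th; apply: (cube_segment th) => //; rewrite scale0r addr0.
set x := y + tau *: delta_mx 0 j.
have [del d0 hdel] := pderivable_eps (pf _ (cyt _ t01)) ltr01.
apply/cvgrPdist_lt => eps e0; rewrite near_withinE.
set l := pderiv j f x in hdel.
have K0 : 0 < `|l| + 1 by rewrite ltr_wpDl.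
apply/nbhs_ballP; exists (Num.min del (eps / (`|l| + 1))) => /=.
  by rewrite lt_min d0 divr_gt0.
move=> u; rewrite /ball /= lt_min distrC => /andP[ud ue]; rewrite in_itv /= => uh.
have [->|ut] := eqVneq u tau; first by rewrite subrr normr0.
have q0 : u - tau != 0 by rewrite subr_eq0.
have := hdel (u - tau) q0 ud.
have xu : x + (u - tau) *: delta_mx 0 j = y + u *: delta_mx 0 j.
  by rewrite /x -addrA -scalerDl [tau + _]addrC subrK.
rewrite /diff_quotient xu => /(_ (cyt _ uh)).
rewrite -[f (y + u *: _)]/(line f y j u) -[f x]/(line f y j tau).
set D := line f y j u - line f y j tau => hD.
have : `|(u - tau)^-1 * D| < `|l| + 1.
  by have := ler_normD ((u - tau)^-1 * D - l) l; rewrite subrK; lra.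
rewrite normrM normfV ltr_pdivrMl ?normr_gt0 // => hD'.
rewrite distrC; apply: lt_trans hD' _.
by rewrite -ltr_pdivlMr.
Qed.

Lemma line_derive f y j (h tau : R) :
  cube y -> cube (y + h *: delta_mx 0 j) ->
  (forall x, cube x -> pderivable j f x) -> tau \in `]0, h[ ->
  is_derive tau 1 (line f y j) (line (pderiv j f) y j tau).
Proof.
move=> cy ch pf; rewrite in_itv /= => /andP[t0 th].
have cyt (t : R) : 0 <= t <= h -> cube (y + t *: delta_mx 0 j).
  by move=> tt; apply: (cube_segment tt) => //; rewrite scale0r addr0.
set x := y + tau *: delta_mx 0 j.
have cx : cube x by apply: cyt; rewrite !ltW.
have lim_q : u^-1 *: ((line f y j \o shift tau) (u *: 1) - line f y j tau)
    @[u --> 0^'] --> pderiv j f x.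
  apply/cvgrPdist_lt => eps e0; rewrite near_withinE.
  have [del d0 hdel] := pderivable_eps (pf _ cx) e0.
  apply/nbhs_ballP; exists (Num.min del (Num.min tau (h - tau))) => /=.
    by rewrite !lt_min d0 t0 subr_gt0.
  move=> u; rewrite /ball /= !lt_min sub0r normrN => /and3P[ud ut uh] u0.
  rewrite distrC /= /shift /= [u *: 1]mulr1 [u + tau]addrC line_add -/x.
  apply: hdel => //; rewrite /x -addrA -scalerDl; apply: cyt.
  by move: ut uh; rewrite !ltr_norml; lra.
apply: DeriveDef; first by apply/cvg_ex; exists (pderiv j f x).
exact: cvg_lim lim_q.
Qed.

(** The innermost difference comes first, as the innermost derivative comes last
    in a word of partial derivatives. *)
Fixpoint fdiff (P : seq ('I_s * R)) f : 'rV[R]_s -> R :=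
  if P is p :: P' then
    fdiff P' (fun y => f (y + p.2 *: delta_mx 0 p.1) - f y)
  else f.

Definition total_step (P : seq ('I_s * R)) : 'rV[R]_s :=
  \sum_(p <- P) p.2 *: delta_mx 0 p.1.

Lemma fdiff_shift (P : seq ('I_s * R)) f (v : 'rV[R]_s) y :
  fdiff P (fun y => f (y + v) - f y) y = fdiff P f (y + v) - fdiff P f y.
Proof.
elim: P f y => [//|p P IH] f y /=; rewrite -IH.
congr (fdiff P _ _); apply/funext => z.
rewrite [z + v + _]addrAC.
set a := f _; set b := f _; set c := f _; set e := f _; ring.
Qed.

Lemma fdiff_cons (p : 'I_s * R) P f y :
  fdiff (p :: P) f y = fdiff P f (y + p.2 *: delta_mx 0 p.1) - fdiff P f y.
Proof. exact: fdiff_shift. Qed.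

Lemma cube_between x y z : cube x -> cube z ->
  (forall i, x 0 i <= y 0 i <= z 0 i) -> cube y.
Proof.
by move=> cx cz h i; have := cx i; have := cz i; have := h i; lra.
Qed.

Lemma total_step_ge0 (P : seq ('I_s * R)) i :
  (forall p, p \in P -> 0 < p.2) -> 0 <= total_step P 0 i.
Proof.
move=> P0; rewrite /total_step summxE big_seq sumr_ge0 // => p pP.
by rewrite !mxE mulr_ge0 // ltW // P0.
Qed.

Lemma line_fdiff (P : seq ('I_s * R)) f y j (h : R) : 0 < h ->
  (forall p, p \in P -> 0 < p.2) ->
  cube y -> cube (y + h *: delta_mx 0 j + total_step P) ->
  (forall x, cube x -> pderivable j f x) ->
  {within `[0, h], continuous (line (fdiff P f) y j)} /\
  (forall tau, tau \in `]0, h[ ->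
    is_derive tau 1 (line (fdiff P f) y j) (line (fdiff P (pderiv j f)) y j tau)).
Proof.
move=> h0; elim: P y => [|[i g] P IH] y P0 cy ch pf.
  have cyh : cube (y + h *: delta_mx 0 j).
    by move: ch; rewrite /total_step big_nil addr0.
  by split=> [|tau th]; [exact: line_continuous|exact: (line_derive cy cyh)].
have g0 : 0 < g by apply: (P0 (i, g)); rewrite mem_head.
have P0' p : p \in P -> 0 < p.2 by move=> pP; apply: P0; rewrite inE pP orbT.
have stepE : total_step ((i, g) :: P) = g *: delta_mx 0 i + total_step P.
  by rewrite /total_step big_cons.
have := ch; rewrite stepE => ch'.
have tP r := total_step_ge0 r P0'.
have [c1 d1] : {within `[0, h], continuous (line (fdiff P f) y j)} /\
  (forall tau, tau \in `]0, h[ ->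
    is_derive tau 1 (line (fdiff P f) y j) (line (fdiff P (pderiv j f)) y j tau)).
  apply: IH => //; apply: (cube_between cy ch') => r.
  have := tP r; rewrite !mxE eqxx /=.
  by case: (r == i); case: (r == j); rewrite /= ?mulr1 ?mulr0; lra.
have cyi : cube (y + g *: delta_mx 0 i).
  apply: (cube_between cy ch') => r.
  have := tP r; rewrite !mxE eqxx /=.
  by case: (r == i); case: (r == j); rewrite /= ?mulr1 ?mulr0; lra.
have [c2 d2] : {within `[0, h], continuous
    (line (fdiff P f) (y + g *: delta_mx 0 i) j)} /\
  (forall tau, tau \in `]0, h[ ->
    is_derive tau 1 (line (fdiff P f) (y + g *: delta_mx 0 i) j)
      (line (fdiff P (pderiv j f)) (y + g *: delta_mx 0 i) j tau)).
  apply: IH => //; congr (cube _): ch'; rewrite !addrA.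
  by congr (_ + _); rewrite addrAC.
have lineE f' : line (fdiff ((i, g) :: P) f') y j =
    line (fdiff P f') (y + g *: delta_mx 0 i) j - line (fdiff P f') y j.
  apply/funext => tau; rewrite /line fdiff_cons /= -[RHS]/(_ - _).
  by rewrite [y + _ + _]addrAC.
split=> [|tau th]; rewrite !lineE.
  by move=> t; apply: cvgB; [exact: c2|exact: c1].
have := is_deriveB (d2 tau th) (d1 tau th).
by [].
Qed.

(** Mean value theorem for iterated differences. *)
Lemma fdiff_bound (P : seq ('I_s * R)) f y (K : R) :
  (forall p, p \in P -> 0 < p.2) ->
  cube y -> cube (y + total_step P) ->
  ex_pderivs (rev (unzip1 P)) f ->
  (forall x, cube x -> `|pderivs (rev (unzip1 P)) f x| <= K) ->
  `|fdiff P f y| <= (\prod_(p <- P) p.2) * K.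
Proof.
elim: P f y => [|[j h] P IH] f y P0 cy ch ex bd.
  by rewrite big_nil mul1r; apply: bd.
have h0 : 0 < h by apply: (P0 (j, h)); rewrite mem_head.
have P0' p : p \in P -> 0 < p.2 by move=> pP; apply: P0; rewrite inE pP orbT.
have pderivs_rcons w : pderivs (rcons w j) f = pderivs w (pderiv j f).
  by elim: w => //= i w ->.
have ex_rcons w : ex_pderivs (rcons w j) f ->
    (forall x, cube x -> pderivable j f x) /\ ex_pderivs w (pderiv j f).
  elim: w => [|i w IHw] /= [e1 e2]; first by split.
  have [pj exw] := IHw e1; split; first exact: pj.
  split; first exact: exw.
  move=> x cx; by move: (e2 x cx); rewrite pderivs_rcons.
move: ex bd; rewrite [unzip1 _]/= rev_cons => /ex_rcons[pf ex]; rewrite pderivs_rcons => bd.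
have ch' : cube (y + h *: delta_mx 0 j + total_step P).
  by move: ch; rewrite /total_step big_cons addrA.
have tP r := total_step_ge0 r P0'.
have [cont der] := line_fdiff h0 P0' cy ch' pf.
have [c c0h] := MVT h0 der cont.
rewrite fdiff_cons /= big_cons /= subr0.
rewrite /line scale0r addr0 => ->; rewrite normrM mulrC gtr0_norm // -mulrA.
rewrite ler_pM2l //; apply: IH => //.
  apply: (cube_between cy ch') => r; move: c0h; rewrite in_itv /= => c0h.
  by have := tP r; rewrite !mxE eqxx /=; case: (r == j); rewrite /= ?mulr1 ?mulr0; lra.
apply: (cube_between cy ch') => r; move: c0h; rewrite in_itv /= => c0h.
by have := tP r; rewrite !mxE eqxx /=; case: (r == j); rewrite /= ?mulr1 ?mulr0; lra.
Qed.

End finite_differences.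

(** * Walsh functions on digit vectors *)

Section walsh.
Variables (R : realFieldType).

Definition sgF2 (a : 'F_2) : R := (-1) ^+ (a != 0).

Lemma sgF2D a b : sgF2 (a + b) = sgF2 a * sgF2 b.
Proof.
by rewrite /sgF2; case: (F2_case a) (F2_case b) => -> [] ->;
  rewrite ?F2_addxx ?addr0 ?add0r ?eqxx ?expr0 ?expr1 ?mulr1 ?mul1r // mulrNN mulr1.
Qed.

Lemma sgF20 : sgF2 0 = 1. Proof. by rewrite /sgF2 eqxx. Qed.
Lemma sgF21 : sgF2 1 = -1. Proof. by rewrite /sgF2 expr1. Qed.

Lemma sgF2_norm a : `|sgF2 a| = 1.
Proof. by case: (F2_case a) => ->; rewrite ?sgF20 ?sgF21 ?normrN normr1. Qed.

Variables (s L : nat).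
Local Notation words := {ffun 'I_s -> 'rV['F_2]_L}.
Implicit Types k x : words.

Definition dot k x : 'F_2 := \sum_j (k j *m (x j)^T) 0 0.

Lemma dotC k x : dot k x = dot x k.
Proof.
by apply: eq_bigr => j _; rewrite -[k j *m _]trmxK trmx_mul trmxK mxE.
Qed.

Lemma dotDr k x y : dot k (x + y) = dot k x + dot k y.
Proof.
by rewrite -big_split; apply: eq_bigr => j _; rewrite ffunE linearD mulmxDr mxE.
Qed.

Lemma dotDl k1 k2 x : dot (k1 + k2) x = dot k1 x + dot k2 x.
Proof. by rewrite dotC dotDr !(dotC x). Qed.

Definition walsh k x : R := sgF2 (dot k x).

Lemma walshDr k x y : walsh k (x + y) = walsh k x * walsh k y.
Proof. by rewrite /walsh dotDr sgF2D. Qed.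

Lemma walshDl k1 k2 x : walsh (k1 + k2) x = walsh k1 x * walsh k2 x.
Proof. by rewrite /walsh dotDl sgF2D. Qed.

Definition unit_word (p : 'I_s * 'I_L) : words :=
  [ffun j => if j == p.1 then delta_mx 0 p.2 else 0].

Lemma dot_unit k p : dot k (unit_word p) = k p.1 0 p.2.
Proof.
rewrite /dot (bigD1 p.1) //= ffunE eqxx trmx_delta delta_dot mxE eqxx mulr1n.
rewrite big1 ?addr0 // => j /negbTE jp.
by rewrite ffunE jp trmx0 mulmx0 mxE.
Qed.

Lemma word_neq0 k : k != 0 -> exists p, k p.1 0 p.2 = 1.
Proof.
move=> k0; have [p kp|nop] := pickP (fun p : 'I_s * 'I_L => k p.1 0 p.2 != 0).
  by exists p; apply/eqP; rewrite -F2_neq0.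
case/eqP: k0; apply/ffunP => j; apply/rowP => l; rewrite ffunE mxE.
by have /negbT := nop (j, l); rewrite negbK => /eqP.
Qed.

Lemma sum_walsh_eq0 k : k != 0 -> \sum_x walsh k x = 0.
Proof.
move=> /word_neq0[p kp]; set S := \sum_x _.
suff : S = - S by lra.
rewrite {1}/S.
have shift_inj : injective (fun x : words => x + unit_word p) by exact: addIr.
rewrite (reindex_inj shift_inj) /S -sumrN; apply: eq_bigr => x _.
by rewrite walshDr [walsh k (unit_word p)]/walsh dot_unit kp sgF21 mulrN1.
Qed.

Definition walsh_coef (g : words -> R) k : R :=
  #|{: words}|%:R^-1 * \sum_x walsh k x * g x.

(** Orthogonality of the Walsh functions on a finite group. *)
Lemma walsh_inversion (g : words -> R) x :
  g x = \sum_k walsh_coef g k * walsh k x.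
Proof.
have N0 : #|{: words}|%:R != 0 :> R.
  by rewrite pnatr_eq0 -lt0n; apply/card_gt0P; exists 0.
rewrite (eq_bigr (fun k =>
    #|{: words}|%:R^-1 * \sum_y g y * walsh k (y + x))); last first.
  move=> k _; rewrite /walsh_coef -mulrA mulr_suml; congr (_ * _).
  by apply: eq_bigr => y _; rewrite walshDr; ring.
rewrite -mulr_sumr exchange_big /= (bigD1 x) //= [X in _ + X]big1 ?addr0.
  rewrite (eq_bigr (fun=> g x)); last first.
    move=> k _; have -> : x + x = 0.
      by apply/ffunP => j; rewrite !ffunE rV2_addxx.
    have -> : walsh k 0 = 1.
      rewrite /walsh /dot big1 ?sgF20 // => j _.
      by rewrite ffunE trmx0 mulmx0 mxE.
    by rewrite mulr1.
  by rewrite sumr_const -(mulr_natl (g x)) mulKf.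
move=> y yx; rewrite -mulr_sumr.
rewrite (eq_bigr (fun k => walsh (y + x) k)).
  rewrite sum_walsh_eq0 ?mulr0 //; apply: contraNneq yx => /ffunP e.
  apply/eqP/ffunP => j; have := e j; rewrite !ffunE => e'.
  by rewrite -[y j]addr0 -(rV2_addxx (x j)) addrA e' add0r.
by move=> k _; rewrite /walsh dotC.
Qed.

End walsh.

Section corner.
Variables (R : realType) (s L : nat).
Local Notation words := {ffun 'I_s -> 'rV['F_2]_L}.
Implicit Types (k x : words) (f : 'rV[R]_s -> R).

(** The corner with smallest coordinates of the dyadic cell of digits x. *)
Definition corner x : 'rV[R]_s :=
  \row_j \sum_(l < L) (x j 0 l == 1)%:R / 2 ^+ l.+1.

Lemma sum_halves n : \sum_(l < n) 2 ^- l.+1 = 1 - 2 ^- n :> R.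
Proof.
elim: n => [|n IH]; first by rewrite big_ord0 expr0 invr1 subrr.
rewrite big_ord_recr /= IH exprS invfM; lra.
Qed.

Lemma cube_corner x : cube (corner x).
Proof.
move=> j; rewrite mxE; apply/andP; split.
  by apply: sumr_ge0 => l _; rewrite divr_ge0 // exprn_ge0.
apply: (@le_trans _ _ (\sum_(l < L) 2 ^- l.+1)).
  apply: ler_sum => l _; rewrite ler_piMl ?invr_ge0 ?exprn_ge0 //.
  by case: (_ == _).
by rewrite sum_halves gerBl invr_ge0 exprn_ge0.
Qed.

Definition step (p : 'I_s * 'I_L) : 'I_s * R := (p.1, 2 ^- p.2.+1).

Lemma corner_unit x p : x p.1 0 p.2 = 0 ->
  corner (x + unit_word p) = corner x + (step p).2 *: delta_mx 0 (step p).1.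
Proof.
move=> xp; apply/rowP => j; rewrite !mxE eqxx /=.
have [->|jp] := eqVneq j p.1; last first.
  rewrite mulr0 addr0; apply: eq_bigr => l _.
  by rewrite !ffunE (negbTE jp) addr0.
rewrite /= mulr1 (bigD1 p.2) //= [in RHS](bigD1 p.2) //= !ffunE eqxx !mxE xp.
rewrite !eqxx add0r /= !mul1r mul0r add0r addrC; congr (_ + _).
apply: eq_bigr => l lp; rewrite ?ffunE ?eqxx ?mxE (negbTE lp).
by rewrite ?andbF addr0.
Qed.

Definition zero_at (Q : seq ('I_s * 'I_L)) x := all (fun p => x p.1 0 p.2 == 0) Q.

Lemma zero_at_unit Q x p : p \notin Q -> zero_at Q (x + unit_word p) = zero_at Q x.
Proof.
move=> pQ; apply: eq_in_all => q qQ; rewrite !ffunE.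
have [qp|_] := eqVneq q.1 p.1; last by rewrite addr0.
rewrite !mxE eqxx /=; have [qp'|_] := eqVneq q.2 p.2; last by rewrite addr0.
by move: pQ; rewrite (surjective_pairing p) -qp -qp' -surjective_pairing qQ.
Qed.

Lemma cube_total_step Q x : uniq Q -> zero_at Q x ->
  cube (corner x + total_step [seq step p | p <- Q]).
Proof.
elim: Q x => [|p Q IH] x /=.
  by move=> _ _; rewrite /total_step big_nil addr0; exact: cube_corner.
move=> /andP[pQ uQ] /andP[/eqP xp zx].
rewrite /total_step big_cons addrA -corner_unit //.
by apply: IH; rewrite // zero_at_unit.
Qed.

(** Summation by parts over the digits listed in Q, on which k does not
    vanish. *)
Lemma sum_walsh_fdiff f k Q : uniq Q -> (forall p, p \in Q -> k p.1 0 p.2 = 1) ->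
  \sum_x walsh R k x * f (corner x) = (-1) ^+ size Q *
  \sum_(x | zero_at Q x) walsh R k x * fdiff [seq step p | p <- Q] f (corner x).
Proof.
elim: Q => [|p Q IH] /=; first by rewrite expr0 mul1r.
move=> /andP[pQ uQ] kQ.
have kp : k p.1 0 p.2 = 1 by apply: kQ; rewrite mem_head.
rewrite IH // => [|q qQ]; last by apply: kQ; rewrite inE qQ orbT.
rewrite exprS -mulrA mulrCA; congr (_ * _).
rewrite (bigID (fun x : words => x p.1 0 p.2 == 0)) /=.
rewrite [X in _ + X](_ : _ = - \sum_(x : words | (x p.1 0 p.2 == 0) && zero_at Q x)
  walsh R k x * fdiff [seq step p | p <- Q] f
    (corner x + (step p).2 *: delta_mx 0 (step p).1)); last first.
  have shift_inj : injective (fun x : words => x + unit_word p) by exact: addIr.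
  rewrite (reindex_inj shift_inj) -sumrN; apply: eq_big => [x|x].
    rewrite zero_at_unit // !ffunE eqxx !mxE !eqxx andbC F2_neq0.
    by case: (F2_case (x p.1 0 p.2)) => ->.
  rewrite zero_at_unit // !ffunE eqxx !mxE !eqxx => /andP[_ xp].
  rewrite walshDr [walsh _ k (unit_word p)]/walsh dot_unit kp sgF21.
  rewrite corner_unit ?mulrN1 ?mulNr //.
  by case: (F2_case (x p.1 0 p.2)) xp => ->.
rewrite (eq_bigl _ _ (fun x : words => andbC (zero_at Q x) _)) -sumrB.
rewrite mulN1r -sumrN; apply: eq_bigr => x _.
by rewrite -[fdiff _ _ (corner x) in RHS]/(fdiff (step p :: _) f (corner x)) fdiff_cons mulrBr opprB.
Qed.

End corner.

(** * Decay of Walsh coefficients *)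

(** The digits at which differences will be taken: the two leading ones, if any. *)
Lemma leading_digits (R : realFieldType) L (k : 'rV['F_2]_L) :
  exists Q : seq 'I_L, [/\ uniq Q, (size Q < 3)%N,
    forall l, l \in Q -> k 0 l = 1 & \prod_(l <- Q) 2 ^- l.+1 = weight R k].
Proof.
have k1 l : k 0 l != 0 -> k 0 l = 1 by rewrite F2_neq0 => /eqP.
have [t0|/top_attained[l kl tl]] := posnP (top k).
  exists [::]; split=> //; rewrite big_nil /weight t0 add0n.
  have := second_le_top k; rewrite t0 leqn0 => /eqP ->.
  by rewrite expr0 invr1.
have [s0|/second_attained[i [ki ti si]]] := posnP (second k).
  exists [:: l]; split=> // [i|]; first by rewrite inE => /eqP ->; exact: k1.
  by rewrite big_seq1 /weight s0 addn0 tl.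
exists [:: l; i]; split=> // [|j|].
- by rewrite /= inE andbT; apply/eqP => li; move: ti; rewrite tl li ltnn.
- by rewrite !inE => /orP[] /eqP ->; exact: k1.
- by rewrite big_cons big_seq1 /weight tl si exprD invfM.
Qed.

Section smoothness.
Variables (R : realType) (s : nat).
Variables (f : 'rV[R]_s -> R) (hf : smooth2 f).

Lemma compact_cube : compact (@cube R s).
Proof.
have := @rV_compact R s (fun=> `[0, 1]%classic) (fun=> @segment_compact R 0 1).
by congr compact; apply/seteqP; split => x h j; have := h j; rewrite /= in_itv.
Qed.

Definition pd_bounded (K : R) : Prop :=
  0 <= K /\ forall (a : {ffun 'I_s -> 'I_3}) x, cube x ->
    `|pderivs (multi_word (fun j => a j : nat)) f x| <= K.

Lemma smooth2_bounded : exists K, pd_bounded K.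
Proof.
have /fin_all_exists[K KP] (a : {ffun 'I_s -> 'I_3}) : exists K : R,
    forall x, cube x -> `|pderivs (multi_word (fun j => a j : nat)) f x| <= K.
  have [_ /continuous_compact/(_ compact_cube)/compact_bounded] := hf a.
  move=> [M [Mreal MP]]; exists (M + 1) => x cx.
  by apply: (MP (M + 1)); [rewrite ltrDl|exists x].
exists (\sum_a `|K a|); split; first by apply: sumr_ge0.
move=> a x cx; apply: le_trans (KP a x cx) _; apply: le_trans (ler_norm _) _.
by rewrite (bigD1 a) //= lerDl sumr_ge0.
Qed.

Variable K : R.
Hypothesis KP : pd_bounded K.

Lemma cube_lipschitz_line z j (h : R) : cube z -> cube (z + h *: delta_mx 0 j) ->
  `|f (z + h *: delta_mx 0 j) - f z| <= K * `|h|.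
Proof.
have pos z' h' : 0 < h' -> cube z' -> cube (z' + h' *: delta_mx 0 j) ->
    `|f (z' + h' *: delta_mx 0 j) - f z'| <= K * h'.
  move=> h0 cz czh; pose a : {ffun 'I_s -> 'I_3} := [ffun i => inord (i == j)].
  have aE : multi_word (fun i => a i : nat) = [:: j].
    rewrite /multi_word; have -> : [seq nseq (a i) i | i <- enum 'I_s] =
        [seq nseq (i == j) i | i <- enum 'I_s].
      by apply: eq_map => i; rewrite ffunE inordK //; case: (i == j).
    rewrite -[RHS](filter_pred1_uniq (enum_uniq 'I_s)) ?mem_enum //.
    by elim: (enum _) => //= i r ->; rewrite /pred1 /=; case: (i == j).
  have [exa _] := hf a; have [_ /(_ a) bd] := KP.
  rewrite aE in exa bd.
  have := @fdiff_bound R s [:: (j, h')] f z' K.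
  rewrite /total_step !big_seq1 /= mulrC; apply=> //.
  by move=> p; rewrite inE => /eqP ->.
move=> cz czh; have [h0|h0|->] := ltgtP h 0.
- rewrite distrC (ltr0_norm h0).
  have zE : z = z + h *: delta_mx 0 j + (- h) *: delta_mx 0 j.
    by rewrite -addrA -scalerDl subrr scale0r addr0.
  have := pos (z + h *: delta_mx 0 j) (- h).
  by rewrite -zE oppr_gt0; apply.
- by rewrite (gtr0_norm h0); exact: pos.
- by rewrite scale0r addr0 subrr normr0 mulr0.
Qed.

Lemma cube_lipschitz (x y : 'rV[R]_s) (del : R) : cube x -> cube y ->
  (forall j, `|x 0 j - y 0 j| <= del) -> `|f x - f y| <= s%:R * K * del.
Proof.
move=> cx cy xy; have K0 : 0 <= K by case: KP.
(* Move from y to x one coordinate at a time. *)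
pose mix n : 'rV[R]_s := \row_j if (j < n)%N then x 0 j else y 0 j.
have cmix n : cube (mix n) by move=> j; rewrite mxE; case: ifP.
have mix0 : mix 0%N = y by apply/rowP => j; rewrite mxE.
have mixs : mix s = x by apply/rowP => j; rewrite mxE ltn_ord.
suff H n : (n <= s)%N -> `|f (mix n) - f y| <= n%:R * K * del.
  by rewrite -[x in f x]mixs; exact: H.
elim: n => [|n IH] ns; first by rewrite mix0 subrr normr0 !mul0r.
pose j := Ordinal ns.
have mixS : mix n.+1 = mix n + (x 0 j - y 0 j) *: delta_mx 0 j.
  apply/rowP => i; rewrite !mxE eqxx /=; have [->|ij] := eqVneq i j.
    by rewrite /= ltnSn ltnn mulr1 addrC subrK.
  rewrite mulr0 addr0 ltnS leq_eqVlt.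
  by rewrite (_ : (i == n :> nat) = false) //; apply/negbTE.
have -> : f (mix n.+1) - f y = f (mix n.+1) - f (mix n) + (f (mix n) - f y).
  by rewrite addrA subrK.
apply: le_trans (ler_normD _ _) _; rewrite -natr1 mulrDl mulrDl mul1r addrC.
apply: lerD; first by apply: IH; exact: ltnW.
rewrite mixS; apply: le_trans (cube_lipschitz_line _ _) _ => //; last first.
  by rewrite ler_wpM2l.
by rewrite -mixS.
Qed.

(** Differencing at the two leading digits of each coordinate of k. *)
Lemma walsh_coef_bound L (k : {ffun 'I_s -> 'rV['F_2]_L}) :
  `|walsh_coef (fun x => f (corner R x)) k| <= K * weights R k.
Proof.
have /fin_all_exists[Q QP] j := leading_digits R (k j).
pose a : {ffun 'I_s -> 'I_3} := [ffun j => inord (size (Q j))].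
have aE j : a j = size (Q j) :> nat by rewrite ffunE inordK; case: (QP j).
pose X r := flatten [seq [seq (j, l) | l <- Q j] | j <- r].
have X1 r : unzip1 (X r) = flatten [seq nseq (a j) j | j <- r].
  elim: r => //= j r IH; rewrite -IH {1}/X /= /unzip1 map_cat.
  by congr (_ ++ _); rewrite -map_comp aE; elim: (Q j) => //= l q ->.
have XP p r : p \in X r -> p.1 \in r /\ p.2 \in Q p.1.
  by move=> /flatten_mapP[j jr /mapP[l lQ ->]].
have Xuniq r : uniq r -> uniq (X r).
  elim: r => //= j r IH /andP[jr ur]; rewrite /X /= cat_uniq IH // andbT.
  apply/andP; split.
    by rewrite map_inj_uniq; [case: (QP j)|move=> ? ? []].
  apply/hasPn => p /XP[pr _]; apply/mapP => -[l _ pE].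
  by move: jr; rewrite -[j]/(j, l).1 -pE pr.
(* The innermost difference is listed first, the innermost derivative last. *)
pose W := rev (X (enum 'I_s)).
have Wuniq : uniq W by rewrite rev_uniq Xuniq // enum_uniq.
have kW p : p \in W -> k p.1 0 p.2 = 1.
  by rewrite mem_rev => /XP[_]; case: (QP p.1) => _ _ + _; apply.
have wordE : rev (unzip1 [seq step R p | p <- W]) =
    multi_word (fun j => a j : nat).
  by rewrite /unzip1 -map_comp -map_rev revK; exact: X1.
have prodE : \prod_(p <- [seq step R p | p <- W]) p.2 = weights R k.
  rewrite big_map; have -> : weights R k =
      \prod_(j <- enum 'I_s) \prod_(l <- Q j) 2 ^- l.+1.
    by rewrite big_enum; apply: eq_bigr => j _; case: (QP j).
  have pW : perm_eq W (X (enum 'I_s)) by rewrite /W perm_rev.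
  rewrite (perm_big _ pW) /X big_flatten big_map /=.
  by apply: eq_bigr => j _; rewrite big_map.
have [exa _] := hf a; have [K0 /(_ a) bd] := KP.
rewrite /walsh_coef (sum_walsh_fdiff _ Wuniq kW) normrM normfV normr_nat.
rewrite normrM normrX normrN1 expr1n mul1r.
have N0 : 0 < #|{: {ffun 'I_s -> 'rV['F_2]_L}}|%:R :> R.
  by rewrite ltr0n; apply/card_gt0P; exists 0.
rewrite ler_pdivrMl //; apply: le_trans (ler_norm_sum _ _ _) _.
apply: (@le_trans _ _ (\sum_(x : {ffun 'I_s -> 'rV['F_2]_L}) K * weights R k)).
  rewrite [leLHS]big_mkcond /=; apply: ler_sum => x _.
  case: ifP => [zx|_]; last by rewrite mulr_ge0 // weights_ge0.
  rewrite normrM sgF2_norm mul1r mulrC -prodE; apply: fdiff_bound.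
  - by move=> p /mapP[q _ ->]; rewrite invr_gt0 exprn_gt0.
  - exact: cube_corner.
  - exact: cube_total_step.
  - by rewrite wordE.
  - by move=> x' cx'; rewrite wordE; exact: bd.
by rewrite sumr_const -[in leLHS]mulr_natl.
Qed.

End smoothness.

(** * Integrals and boxes *)

Section finite_measure_integrals.
Context d (T : measurableType d) (R : realType).
Variables (mu : {measure set T -> \bar R}) (D : set T).
Hypotheses (mD : measurable D) (D_oo : (mu D < +oo)%E).

Lemma bounded_Rintegrable (F : T -> R) (K : R) : measurable_fun D F ->
  (forall x, D x -> `|F x| <= K) -> mu.-integrable D (EFin \o F).
Proof.
move=> mF FK; apply: measurable_bounded_integrable => //.
exists K; split; first exact: num_real.
by move=> M KM x Dx /=; apply: le_trans (FK x Dx) _; exact: ltW.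
Qed.

Lemma Rintegral_dist (F G : T -> R) (eps : R) :
  mu.-integrable D (EFin \o F) -> mu.-integrable D (EFin \o G) ->
  (forall x, D x -> `|F x - G x| <= eps) ->
  `|Rintegral mu D F - Rintegral mu D G| <= eps * fine (mu D).
Proof.
move=> iF iG FG; rewrite -RintegralB // -Rintegral_cst //.
have iFG : mu.-integrable D (EFin \o (fun x => F x - G x)).
  rewrite (_ : _ \o _ = (EFin \o F) \- (EFin \o G))%E; first exact: integrableB.
  by apply/funext => x; rewrite /= EFinB.
apply: le_trans (le_normr_Rintegral mD iFG) _.
apply: le_Rintegral => //.
- exact: (integrable_norm iFG).
- apply: (@bounded_Rintegrable _ `|eps|) => //; exact: measurable_cst.
Qed.

Lemma measurable_uniform_limit (F : T -> R) (phi : nat -> T -> R)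
    (eps : nat -> R) :
  (forall n, measurable_fun D (phi n)) -> eps @ \oo --> 0 ->
  (forall n x, D x -> `|F x - phi n x| <= eps n) -> measurable_fun D F.
Proof.
move=> mphi eps0 Fphi; apply: (measurable_realfun.measurable_fun_cvg mphi).
move=> x Dx; apply/cvgrPdist_le => e e0.
move/cvgrPdist_lt : eps0 => /(_ e e0); apply: filterS => n.
rewrite sub0r normrN => en; apply: le_trans (Fphi n x Dx) _.
by apply: le_trans (ltW en); exact: ler_norm.
Qed.

Lemma measurable_sum_indic (I : finType) (c : I -> R) (A : I -> set T) :
  (forall i, measurable (A i)) ->
  measurable_fun D (fun x => \sum_i c i * \1_(A i) x).
Proof.
move=> mA; by apply: measurable_sum => i; exact: measurable_funM.
Qed.

Lemma Rintegral_sum_indic (I : finType) (c : I -> R) (A : I -> set T) :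
  (forall i, measurable (A i)) ->
  Rintegral mu D (fun x => \sum_i c i * \1_(A i) x) =
  \sum_i c i * fine (mu (A i `&` D)).
Proof.
move=> mA; have mt i : measurable_fun D (fun x => c i * \1_(A i) x).
  exact: measurable_funM.
have ind1 i x : `|\1_(A i) x| <= 1 :> R.
  by rewrite indicE; case: (_ \in _); rewrite ?normr1 ?normr0.
have it r : mu.-integrable D (EFin \o (fun x => \sum_(i <- r) c i * \1_(A i) x)).
  apply: (@bounded_Rintegrable _ (\sum_(i <- r) `|c i|)) => [|x _].
    exact: measurable_sum.
  apply: le_trans (ler_norm_sum _ _ _) _; apply: ler_sum => i _.
  by rewrite normrM ler_piMr.
elim: (index_enum I) => [|i r IH].
  rewrite big_nil -[RHS](mul0r (fine (mu D))) -Rintegral_cst //.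
  by apply: eq_Rintegral => x _; rewrite big_nil.
have i1 : mu.-integrable D (EFin \o (\1_(A i) : T -> R)).
  exact: (@bounded_Rintegrable _ 1).
rewrite big_cons -IH.
have -> : c i * fine (mu (A i `&` D)) = Rintegral mu D (fun x => c i * \1_(A i) x).
  by rewrite RintegralZl // /Rintegral integral_indic.
rewrite -RintegralD //; last first.
  by have := it [:: i]; under eq_fun do rewrite big_seq1.
by apply: eq_Rintegral => x _; rewrite big_cons.
Qed.

End finite_measure_integrals.

Section boxes.
Variable (R : realType).

Definition box n (B : 'I_n -> set R) : set (n.-tuple (measurableTypeR R)) :=
  [set t | forall j, B j (tnth t j)].

Lemma measurable_box n (B : 'I_n -> set R) :
  (forall j, measurable (B j)) -> measurable (box B).
Proof.
move=> mB; have -> : box B = \bigcap_(j in [set: 'I_n])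
    ((fun t : n.-tuple (measurableTypeR R) => tnth t j) @^-1` B j).
  by apply/seteqP; split => t h j; [move=> _; exact: h|exact: (h j I)].
apply: fin_bigcap_measurable => [|j _]; first exact: finite_finset.
rewrite -[X in measurable X]setTI; apply: measurable_tnth => //; exact: mB.
Qed.

Lemma box_measure n (B : 'I_n -> set R) : (forall j, measurable (B j)) ->
  lebesgue_tuple R n (box B) = (\prod_j lebesgue_measure (B j))%E.
Proof.
rewrite /lebesgue_tuple; elim: n B => [|n IH] B mB.
  rewrite big_ord0 /= diracE (_ : [tuple] \in box B) //.
  by rewrite inE => -[].
rewrite big_ord_recl /= /cons_measure /pushforward.
have -> : (fun p : measurableTypeR R * n.-tuple (measurableTypeR R) =>
      [tuple of p.1 :: p.2]) @^-1` box B =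
    B ord0 `*` box (fun j => B (lift ord0 j)).
  apply/seteqP; split => [[x t] h|[x t] [h0 h] j].
    split; first by have := h ord0; rewrite (tnth_nth x).
    by move=> j; have := h (lift ord0 j); rewrite !(tnth_nth x).
  case: (unliftP ord0 j) => [i|] ->; rewrite (tnth_nth x) //=.
  by have := h i; rewrite (tnth_nth x).
rewrite product_measure1E; first by rewrite IH // => j; exact: mB.
  exact: mB.
by apply: measurable_box => j; exact: mB.
Qed.

End boxes.

(** * Riemann sums over dyadic cells *)

Section binary.
Variable L : nat.

Lemma bit_sum n (b : nat -> bool) i :
  bit (\sum_(l < n) b l * 2 ^ l) i = (i < n)%N && b i.
Proof.
elim: n b i => [|n IH] b i; first by rewrite big_ord0 /bit div0n.
have -> : (\sum_(l < n.+1) b l * 2 ^ l =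
    b 0 + (\sum_(l < n) b l.+1 * 2 ^ l).*2)%N.
  rewrite big_ord_recl expn0 muln1 -mul2n big_distrr /=; congr (_ + _)%N.
  by apply: eq_bigr => l _; rewrite expnS mulnCA.
case: i => [|i].
  by rewrite /bit expn0 divn1 oddD odd_double addbF; case: (b 0%N).
rewrite ltnS -(IH (fun l => b l.+1)) /bit expnS divnMA.
by rewrite divn2 half_bit_double.
Qed.

Definition binval (v : 'rV['F_2]_L) : nat := (\sum_(l < L) (v 0%R l == 1%R) * 2 ^ l)%N.

Lemma binval_bit v (l : 'I_L) : bit (binval v) l = (v 0 l == 1).
Proof.
pose b (i : nat) := if insub i is Some l then v 0 (l : 'I_L) == 1 else false.
have bE (i : 'I_L) : b i = (v 0 i == 1) by rewrite /b valK.
rewrite -bE -[RHS]andTb -(ltn_ord l) -bit_sum /binval; congr bit.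
by apply: eq_bigr => i _; rewrite bE.
Qed.

Lemma binval_high v l : (L <= l)%N -> bit (binval v) l = false.
Proof.
move=> Ll.
pose b (i : nat) := if insub i is Some l then v 0 (l : 'I_L) == 1 else false.
have bE (i : 'I_L) : b i = (v 0 i == 1) by rewrite /b valK.
have -> : binval v = (\sum_(l < L) b l * 2 ^ l)%N.
  by apply: eq_bigr => i _; rewrite bE.
by rewrite bit_sum ltnNge Ll.
Qed.

Lemma binval_inj : injective binval.
Proof.
move=> v w vw; apply/rowP => l.
have := binval_bit w l; rewrite -vw binval_bit.
by case: (F2_case (v 0 l)) (F2_case (w 0 l)) => -> [] ->.
Qed.

Lemma binval_lt v : (binval v < 2 ^ L)%N.
Proof.
rewrite /binval; elim: L v => [|n IH] v; first by rewrite big_ord0.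
rewrite big_ord_recr /= expnS mul2n -addnn -addSn leq_add //.
  apply: leq_ltn_trans (IH (\row_i v 0 (widen_ord (leqnSn n) i))).
  by apply: leq_sum => i _; rewrite mxE.
by case: (_ == _); rewrite ?mul1n ?mul0n.
Qed.

Definition binord v : 'I_(2 ^ L) := Ordinal (binval_lt v).

Lemma binord_bij : bijective binord.
Proof.
apply: inj_card_bij; last by rewrite card_ord card_mx mul1n card_ord.
by move=> v w [] /binval_inj.
Qed.

End binary.

Section riemann.
Variables (R : realType) (s : nat).
Variables (f : 'rV[R]_s -> R) (hf : smooth2 f) (K : R) (KP : pd_bounded f K).
Local Notation mu := (lebesgue_tuple R s).
Local Notation D := (row_of_tuple (R := R) (s := s) @^-1` @cube R s).

(** Closed on the right, so that these intervals partition the closed unit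
    interval. *)
Definition dyadic L (i : nat) : set R :=
  if i is 0%N then [set` `[0, 2 ^- L]]
  else [set` `](i%:R / 2 ^+ L), (i.+1%:R / 2 ^+ L)]].

Lemma measurable_dyadic L i : measurable (dyadic L i).
Proof. by case: i => [|i]; exact: measurable_itv. Qed.

Lemma dyadic_measure L i : lebesgue_measure (dyadic L i) = (2 ^- L)%:E.
Proof.
have h0 : 0 < 2 ^- L :> R by rewrite invr_gt0 exprn_gt0.
case: i => [|i]; rewrite /dyadic lebesgue_measure_itv /= lte_fin.
  by rewrite h0 -EFinB subr0.
rewrite ltr_pM2r // ltr_nat ltnSn -EFinB -mulrBl; congr EFin.
by rewrite -natrB // subSnn mul1r.
Qed.

Lemma dyadic_bounds L i (y : R) : dyadic L i y ->
  i%:R / 2 ^+ L <= y <= i.+1%:R / 2 ^+ L.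
Proof.
case: i => [|i]; rewrite /dyadic /= in_itv /=.
  by rewrite mul0r mul1r.
by move=> /andP[/ltW -> ->].
Qed.

Lemma dyadic_exists L (y : R) : 0 <= y <= 1 ->
  exists i : 'I_(2 ^ L), dyadic L i y.
Proof.
move=> /andP[y0 y1]; have h0 : 0 < 2 ^+ L :> R by rewrite exprn_gt0.
have L0 : (0 < 2 ^ L)%N by rewrite expn_gt0.
have ex : exists i, y <= i.+1%:R / 2 ^+ L.
  by exists (2 ^ L).-1; rewrite prednK // natrX divff ?gt_eqF.
(* The first interval whose right end is at least y. *)
case: (ex_minnP ex) => i yi imin.
have iL : (i < 2 ^ L)%N.
  rewrite -[X in (_ < X)%N]prednK // ltnS; apply: imin.
  by rewrite prednK // natrX divff ?gt_eqF.
exists (Ordinal iL) => /=; rewrite /dyadic; move: imin yi {iL}.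
case: i => [|i] imin yi; rewrite /= in_itv /=; first by rewrite y0 -[2 ^- L]mul1r.
rewrite yi andbT ltNge; apply/negP => /imin.
by rewrite ltnn.
Qed.

Lemma dyadic_unique L i i' (y : R) : dyadic L i y -> dyadic L i' y -> i = i'.
Proof.
have h0 : 0 < 2 ^- L :> R by rewrite invr_gt0 exprn_gt0.
have lt_absurd j j' : (j < j')%N -> dyadic L j y -> dyadic L j' y -> False.
  move=> jj' /dyadic_bounds/andP[_ yj].
  case: j' jj' => // j' jj'; rewrite /dyadic /= in_itv /= => /andP[j'y _].
  have := lt_le_trans j'y yj; rewrite ltr_pM2r // ltr_nat.
  by move: jj'; clear; lia.
move=> yi yi'; case: (ltngtP i i') => // h; exfalso.
  exact: (lt_absurd _ _ h).
exact: (lt_absurd _ _ h).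
Qed.

Definition cell L (i : {ffun 'I_s -> 'I_(2 ^ L)}) := box (fun j => dyadic L (i j)).

Definition cell_corner L (i : {ffun 'I_s -> 'I_(2 ^ L)}) : 'rV[R]_s :=
  \row_j ((i j)%:R / 2 ^+ L).

Lemma cube_cell_corner L (i : {ffun 'I_s -> 'I_(2 ^ L)}) : cube (cell_corner i).
Proof.
move=> j; rewrite mxE; apply/andP; split; first by rewrite divr_ge0 ?exprn_ge0.
rewrite ler_pdivrMr ?exprn_gt0 // mul1r -natrX ler_nat; exact: ltnW.
Qed.

Lemma cell_measure L (i : {ffun 'I_s -> 'I_(2 ^ L)}) :
  mu (cell i) = (2 ^- (L * s))%:E.
Proof.
rewrite box_measure => [|j]; last exact: measurable_dyadic.
rewrite (eq_bigr (fun=> (2 ^- L)%:E)) => [|j _]; last exact: dyadic_measure.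
by rewrite prodEFin prodr_const card_ord exprVn exprM.
Qed.

Lemma cell_cube L (i : {ffun 'I_s -> 'I_(2 ^ L)}) : cell i `<=` D.
Proof.
move=> t ti j; rewrite mxE; have /dyadic_bounds/andP[h1 h2] := ti j.
have h0 : 0 < 2 ^+ L :> R by rewrite exprn_gt0.
apply/andP; split; first by apply: le_trans h1; rewrite divr_ge0 ?exprn_ge0.
apply: le_trans h2 _; rewrite ler_pdivrMr // mul1r -natrX ler_nat.
exact: ltn_ord.
Qed.

Lemma cube_box : D = box (fun=> `[0, 1]%classic).
Proof.
apply/seteqP; split => t h j; have := h j; rewrite /= in_itv /= ?mxE //.
Qed.

Lemma measurable_cube : measurable D.
Proof. by rewrite cube_box; apply: measurable_box => j; exact: measurable_itv. Qed.

Lemma cube_measure : mu D = 1%E.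
Proof.
rewrite cube_box box_measure => [|j]; last exact: measurable_itv.
by rewrite big1 // => j _; rewrite lebesgue_measure_itv /= lte_fin ltr01 oppr0 adde0.
Qed.

Definition cell_step L (t : s.-tuple (measurableTypeR R)) : R :=
  \sum_(i : {ffun 'I_s -> 'I_(2 ^ L)}) f (cell_corner i) * \1_(cell i) t.

Lemma cell_step_close L t : D t ->
  `|f (row_of_tuple t) - cell_step L t| <= s%:R * K * 2 ^- L.
Proof.
move=> Dt.
have /fin_all_exists[i iP] (j : 'I_s) : exists i : 'I_(2 ^ L), dyadic L i (tnth t j).
  by apply: dyadic_exists; have := Dt j; rewrite mxE.
pose ii : {ffun 'I_s -> 'I_(2 ^ L)} := [ffun j => i j].
have tii : cell ii t by move=> j; rewrite ffunE; exact: iP.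
have -> : cell_step L t = f (cell_corner ii).
  rewrite /cell_step (bigD1 ii) //= big1 ?addr0.
    by rewrite indicE mem_set // mulr1.
  move=> i' /eqP ii'; rewrite indicE memNset ?mulr0 // => ti'; apply: ii'.
  apply/ffunP => j; apply/val_inj.
  exact: (dyadic_unique (ti' j) (tii j)).
have cx : cube (row_of_tuple t) by exact: Dt.

apply: (cube_lipschitz hf KP cx (cube_cell_corner ii)) => j.
rewrite !mxE ffunE; have /dyadic_bounds/andP[h1 h2] := iP j.
rewrite ger0_norm ?subr_ge0 //; move: h2; rewrite -natr1 mulrDl mul1r; lra.
Qed.

Lemma measurable_f_tuple : measurable_fun D (f \o @row_of_tuple R s).
Proof.
apply: (@measurable_uniform_limit _ _ _ D _ cell_step (fun L => s%:R * K * 2 ^- L)).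
- move=> L; apply: measurable_sum_indic => i.
  by apply: measurable_box => j; exact: measurable_dyadic.
- rewrite -[X in _ --> X](mulr0 (s%:R * K)); apply: cvgMr.
  under eq_fun do rewrite -exprVn.
  by apply: cvg_expr; rewrite ger0_norm ?invr_ge0 // invf_lt1 ?ltr1n.
- by move=> L t Dt; exact: cell_step_close.
Qed.

Lemma riemann_cells L :
  `|cube_integral f - 2 ^- (L * s) *
    \sum_(i : {ffun 'I_s -> 'I_(2 ^ L)}) f (cell_corner i)| <= s%:R * K * 2 ^- L.
Proof.
have mD := measurable_cube.
have D_oo : (mu D < +oo)%E by rewrite cube_measure ltry.
have mcell (i : {ffun 'I_s -> 'I_(2 ^ L)}) : measurable (cell i).
  by apply: measurable_box => j; exact: measurable_dyadic.
have K0 : 0 <= K by case: KP.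
have [fb fbP] : exists B, forall t, D t -> `|f (row_of_tuple t)| <= B.
  exists (`|f 0| + s%:R * K * 1) => t Dt.
  have c0 : cube (0 : 'rV[R]_s) by move=> j; rewrite mxE lexx ler01.
  have := @cube_lipschitz _ _ _ hf _ KP (row_of_tuple t) 0 1 Dt c0.
  move=> /(_ _)/(le_trans (lerB_dist _ _)); rewrite lerBlDl; apply.
  by move=> j; have := Dt j; rewrite !mxE subr0 ler_norml; lra.
have -> : 2 ^- (L * s) * \sum_(i : {ffun 'I_s -> 'I_(2 ^ L)}) f (cell_corner i) =
    Rintegral mu D (cell_step L).
  rewrite Rintegral_sum_indic // mulr_sumr; apply: eq_bigr => i _.
  rewrite (setIidl (@cell_cube L i)) mulrC; congr (_ * _).
  exact: (esym (congr1 fine (cell_measure i))).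
have := @Rintegral_dist _ _ _ mu D mD D_oo (f \o @row_of_tuple R s) (cell_step L)
  (s%:R * K * 2 ^- L).
rewrite [fine _](_ : _ = 1); last exact: (congr1 fine cube_measure).
rewrite mulr1; apply.
- exact: (bounded_Rintegrable mD D_oo measurable_f_tuple fbP).
- apply: (@bounded_Rintegrable _ _ _ mu D mD D_oo _ (fb + s%:R * K * 2 ^- L)).
    exact: measurable_sum_indic.
  move=> t Dt; have h1 := fbP t Dt; have h2 := cell_step_close L Dt.
  have := ler_normB (f (row_of_tuple t)) (f (row_of_tuple t) - cell_step L t).
  by rewrite opprB addrC subrK; lra.
- by move=> t Dt; exact: cell_step_close.
Qed.

(** The corners attached to digit vectors are those of the dyadic cells. *)
Lemma riemann L :
  `|cube_integral f -
    walsh_coef (fun x => f (corner R x)) (0 : {ffun 'I_s -> 'rV['F_2]_L})| <=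
  s%:R * K * 2 ^- L.
Proof.
(* Corners are read from the most significant digit, integers from the least
   significant one. *)
pose flip (v : 'rV['F_2]_L) : 'rV['F_2]_L := \row_l v 0 (rev_ord l).
have flipK : involutive flip.
  by move=> v; apply/rowP => l; rewrite !mxE rev_ordK.
pose g (x : {ffun 'I_s -> 'rV['F_2]_L}) : {ffun 'I_s -> 'I_(2 ^ L)} :=
  [ffun j => binord (flip (x j))].
have g_bij : bijective g.
  have [h hK Kh] := @binord_bij L.
  exists (fun i : {ffun 'I_s -> 'I_(2 ^ L)} => [ffun j => flip (h (i j))]).
    by move=> x; apply/ffunP => j; rewrite !ffunE hK flipK.
  by move=> i; apply/ffunP => j; rewrite !ffunE flipK Kh.
have cornerE x : cell_corner (g x) = corner R x.
  apply/rowP => j; rewrite !mxE ffunE /= /binval natr_sum mulr_suml.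
  rewrite (reindex_inj rev_ord_inj) /=; apply: eq_bigr => l _.
  rewrite mxE rev_ordK natrM natrX -mulrA; congr (_ * _).
  have -> : 2 ^+ L = 2 ^+ (L - l.+1) * 2 ^+ l.+1 :> R.
    by rewrite -exprD subnK.
  by rewrite invfM mulrA divff ?mul1r // expf_neq0.
have := riemann_cells L.
rewrite (reindex g) /=; last exact: onW_bij.
have -> // : 2 ^- (L * s) * \sum_x f (cell_corner (g x)) =
  walsh_coef (fun x => f (corner R x)) (0 : {ffun 'I_s -> 'rV['F_2]_L}).
rewrite /walsh_coef card_ffun card_mx !card_ord mul1n -expnM natrX.
congr (_ * _); apply: eq_bigr => x _; rewrite cornerE.
rewrite /walsh dotC /dot big1 ?sgF20 ?mul1r // => j _.
by rewrite ffunE trmx0 mulmx0 mxE.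
Qed.

End riemann.

(** * The law of finitely many digits *)

Section truncated_law.
Context d (T : measurableType d) (R : realType) (P : probability T R).
Variables (s m : nat) (S : scrambling P s m) (L : nat).
Local Notation mats := {ffun 'I_s -> 'M['F_2]_(L, m)}.
Local Notation words := {ffun 'I_s -> 'rV['F_2]_L}.

Definition trunc_mx (w : T) : mats :=
  [ffun j => \matrix_(l, c) (scr_mx S j l c w)%:R].

Definition trunc_shift (w : T) : words :=
  [ffun j => \row_l (scr_shift S j l w)%:R].

Definition trunc_event (p : mats * words) : set T :=
  [set w | trunc_mx w = p.1 /\ trunc_shift w = p.2].

Definition trunc_law (M : mats) (D : words) : R := fine (P (trunc_event (M, D))).

Lemma bool_F2 (b : bool) : (b%:R == 1 :> 'F_2) = b.
Proof. by case: b. Qed.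

Lemma F2_bool (x : 'F_2) : (x == 1)%:R = x.
Proof. by case: (F2_case x) => ->. Qed.

Lemma trunc_mx_lower w : unit_lower (trunc_mx w).
Proof.
move=> j l c; rewrite ffunE mxE; split=> lc; last by rewrite scr_upper.
by rewrite lc scr_diag.
Qed.

Definition random_indices : {fset entry_index s m} :=
  [fset e in
    [seq inl (x.1.1, nat_of_ord x.1.2, x.2) |
      x : 'I_s * 'I_L * 'I_m <- enum {: 'I_s * 'I_L * 'I_m} &
      (x.2 < x.1.2)%N] ++
    [seq inr (x.1, nat_of_ord x.2) |
      x : 'I_s * 'I_L <- enum {: 'I_s * 'I_L}] : seq (entry_index s m)]%fset.

(** The value of a random entry on the event that p is observed. *)
Definition prescribed (p : mats * words) (e : entry_index s m) : bool :=
  match e with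
  | inl (j, l, c) => if insub l is Some l' then p.1 j l' c == 1 else false
  | inr (j, l) => if insub l is Some l' then p.2 j 0 l' == 1 else false
  end.

Lemma trunc_eventE (p : mats * words) : unit_lower p.1 ->
  trunc_event p = \bigcap_(e in [set` random_indices])
    (entry (scr_mx S) (scr_shift S) e @^-1` [set prescribed p e]).
Proof.
move=> up; apply/seteqP; split=> w.
  move=> [p1 p2] e /=; rewrite !inE ?mem_cat => /orP[].
    case/mapP => -[[j l] c]; rewrite mem_filter => /andP[lc _] -> /=.
    by rewrite valK -p1 ffunE mxE bool_F2.
  by case/mapP => -[j l] _ -> /=; rewrite valK -p2 ffunE mxE bool_F2.
move=> h; split; apply/ffunP => j; rewrite ffunE; last first.
  apply/rowP => l; rewrite mxE -[RHS]F2_bool.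
  have := h (inr (j, l : nat)); rewrite /= valK => -> //.
  rewrite !inE ?mem_cat; apply/orP; right.
  by apply/mapP; exists (j, l) => //; rewrite mem_enum.
apply/matrixP => l c; rewrite mxE; have [lc|cl|lc] := ltngtP l c.
- by rewrite scr_upper // (proj2 (up j l c)).
- rewrite -[RHS]F2_bool; have := h (inl (j, l : nat, c)); rewrite /= valK => -> //.
  rewrite !inE ?mem_cat; apply/orP; left.
  by apply/mapP; exists (j, l, c) => //; rewrite mem_filter cl mem_enum.
- by rewrite (proj1 (up j l c)) // lc scr_diag.
Qed.

Lemma trunc_event_empty (p : mats * words) : ~ unit_lower p.1 ->
  trunc_event p = set0.
Proof.
move=> up; apply/seteqP; split=> // w [Mw _]; apply: up; rewrite -Mw.
exact: trunc_mx_lower.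
Qed.

Lemma entry_measurable e b :
  measurable (entry (scr_mx S) (scr_shift S) e @^-1` [set b]).
Proof. by rewrite -[X in measurable X]setTI; exact: measurable_funP. Qed.

Lemma measurable_trunc_event p : measurable (trunc_event p).
Proof.
have [up|up] := pselect (unit_lower p.1); last by rewrite trunc_event_empty.
rewrite trunc_eventE //; apply: fin_bigcap_measurable.
  exact: finite_fset.
by move=> e _; exact: entry_measurable.
Qed.

(** By independence all admissible values of the random digits are equally
    likely. *)
Lemma trunc_lawE M D : trunc_law M D =
  if `[< unit_lower M >] then 2 ^- #|` random_indices| else 0.
Proof.
rewrite /trunc_law; case: ifPn => [/asboolP up|/asboolPn up]; last first.
  by rewrite trunc_event_empty // measure0.
have sub : [set` random_indices] `<=` @random_entry s m.
  move=> e /=; rewrite !inE ?mem_cat => /orP[].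
    by case/mapP => -[[j l] c]; rewrite mem_filter => /andP[lc _] ->.
  by case/mapP => -[j l] _ ->.
rewrite trunc_eventE // (scr_indep S sub) // big_seq_cond.
rewrite (eq_bigr (fun=> (2^-1)%:E)); last first.
  by move=> e /andP[eJ _]; apply: scr_uniform; apply: sub.
rewrite prodEFin -big_seq_cond /= big_const_seq count_predT iter_mulr_1.
by rewrite exprVn.
Qed.

Lemma trunc_law_ge0 M D : 0 <= trunc_law M D.
Proof. by rewrite trunc_lawE; case: ifP => // _; rewrite invr_ge0 exprn_ge0. Qed.

Lemma trunc_law_shift M D E D' : strict_lower E ->
  trunc_law (M + E) (D + D') = trunc_law M D.
Proof.
move=> lE; rewrite !trunc_lawE; congr (if _ then _ else _).
apply/asboolP/asboolP => uM j l c; have [h1 h2] := uM j l c; split=> lc.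
- by rewrite -(h1 lc) !ffunE mxE lE ?addr0 // lc.
- by rewrite -(h2 lc) !ffunE mxE lE ?addr0 // ltnW.
- by rewrite !ffunE mxE lE ?addr0 ?h1 // lc.
- by rewrite !ffunE mxE lE ?addr0 ?h2 // ltnW.
Qed.

Lemma trunc_law_supp M D : trunc_law M D != 0 -> unit_lower M.
Proof. by rewrite trunc_lawE; case: ifPn => [/asboolP//|_ /eqP]. Qed.

Lemma trunc_expectation (F : mats -> words -> R) :
  Rintegral P setT (fun w => F (trunc_mx w) (trunc_shift w)) =
  \sum_M \sum_D trunc_law M D * F M D.
Proof.
rewrite pair_bigA /=.
under eq_bigr => p _ do rewrite mulrC /trunc_law -[X in P X]setIT -surjective_pairing.
have Poo : (P setT < +oo)%E by rewrite probability_setT ltry.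
rewrite -(Rintegral_sum_indic measurableT Poo (fun p => F p.1 p.2)
  measurable_trunc_event).
apply: eq_Rintegral => w _; rewrite (bigD1 (trunc_mx w, trunc_shift w)) //=.
rewrite indicE mem_set // mulr1 big1 ?addr0 // => -[M D] /eqP ne.
by rewrite indicE memNset ?mulr0 // => -[/= e1 e2]; apply: ne; rewrite e1 e2.
Qed.

Lemma measurable_trunc (F : mats -> words -> R) :
  measurable_fun setT (fun w => F (trunc_mx w) (trunc_shift w)).
Proof.
have -> : (fun w => F (trunc_mx w) (trunc_shift w)) =
    (fun w => \sum_p F p.1 p.2 * \1_(trunc_event p) w).
  apply/funext => w; rewrite (bigD1 (trunc_mx w, trunc_shift w)) //=.
  rewrite indicE mem_set // mulr1 big1 ?addr0 // => -[M D] /eqP ne.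
  by rewrite indicE memNset ?mulr0 // => -[/= e1 e2]; apply: ne; rewrite e1 e2.
exact: measurable_sum_indic measurable_trunc_event.
Qed.

Lemma trunc_law_sum : \sum_M \sum_D trunc_law M D = 1.
Proof.
have := trunc_expectation (fun _ _ => 1).
under eq_bigr do under eq_bigr do rewrite mulr1.
move=> <-; rewrite Rintegral_cst // mul1r.
exact: (congr1 fine (probability_setT P)).
Qed.

Definition mx_law (M : mats) : R := \sum_D trunc_law M D.

Lemma mx_law_invariant : invariant_law mx_law.
Proof.
split=> [M||M E lE].
- by apply: sumr_ge0 => D _; exact: trunc_law_ge0.
- exact: trunc_law_sum.
- by apply: eq_bigr => D _; rewrite -[D in LHS]addr0 trunc_law_shift.
Qed.

Lemma mx_law_supp M : mx_law M != 0 -> unit_lower M.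
Proof.
have [//|nu] := pselect (unit_lower M); rewrite /mx_law big1 ?eqxx // => D _.
by apply/eqP/negPn/negP => /trunc_law_supp.
Qed.

End truncated_law.

(** * Truncation of the error *)

Lemma binary_series_tail (R : realType) (u : nat -> R) (L : nat) :
  (forall l, 0 <= u l <= 2 ^- l.+1) ->
  0 <= limn (series u) - series u L <= 2 ^- L.
Proof.
move=> hu; have u0 l : 0 <= u l by have /andP[] := hu l.
have nd : nondecreasing_seq (series u).
  by apply: nondecreasing_series => l _ _; exact: u0.
have tail n : series u (L + n)%N - series u L <= 2 ^- L - 2 ^- (L + n).
  elim: n => [|n IH]; first by rewrite addn0 !subrr.
  have ul : u (L + n)%N <= 2 ^- (L + n).+1.
    by have /andP[] := hu (L + n)%N.
  have sS : series u (L + n).+1 = series u (L + n)%N + u (L + n)%N.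
    by rewrite /series /= big_nat_recr.
  rewrite addnS sS.
  move: IH ul; rewrite exprS invfM; lra.
have ub n : series u n <= series u L + 2 ^- L.
  have [nL|Ln] := leqP n L.
    by apply: le_trans (nd _ _ nL) _; rewrite lerDl invr_ge0 exprn_ge0.
  have := tail (n - L)%N; rewrite subnKC; last exact: ltnW.
  by have : 0 <= 2 ^- n :> R; [rewrite invr_ge0 exprn_ge0|lra].
have cv : cvgn (series u).
  apply: nondecreasing_is_cvgn => //; exists (series u L + 2 ^- L).
  by move=> _ [n _ <-].
rewrite subr_ge0 lerBlDl; apply/andP; split.
  apply: limr_ge => //; exists L => // n /= Ln; exact: nd.
by apply: limr_le => //; exists 0%N.
Qed.

Section truncated_error.
Context d (T : measurableType d) (R : realType) (P : probability T R).
Variables (s m : nat) (S : scrambling P s m) (C : gen_matrices s m).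
Variables (f : 'rV[R]_s -> R) (hf : smooth2 f) (K : R) (KP : pd_bounded f K).

Definition natcol (i : nat) : 'cV['F_2]_m := \col_c (bit i c)%:R.

Definition net_word L (M : {ffun 'I_s -> 'M['F_2]_(L, m)})
    (D : {ffun 'I_s -> 'rV['F_2]_L}) (i : nat) : {ffun 'I_s -> 'rV['F_2]_L} :=
  [ffun j => (M j *m C j *m natcol i)^T + D j].

Lemma net_digitE L i j (l : 'I_L) w :
  net_digit S C i j l w =
  net_word (trunc_mx S L w) (trunc_shift S L w) i j 0 l.
Proof.
rewrite /net_digit !ffunE !mxE; congr (_ + _).
apply: eq_bigr => c _; congr (_ * _); rewrite !mxE.
by apply: eq_bigr => c' _; rewrite !mxE.
Qed.

Lemma net_point_bounds L i j w :
  0 <= net_point S C i w 0 j -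
    corner R (net_word (trunc_mx S L w) (trunc_shift S L w) i) 0 j <= 2 ^- L.
Proof.
have := @binary_series_tail R
  (fun l => (net_digit S C i j l w == 1)%:R / 2 ^+ l.+1) L.
have hu l : 0 <= ((net_digit S C i j l w == 1)%:R / 2 ^+ l.+1 : R) <= 2 ^- l.+1.
  rewrite divr_ge0 ?exprn_ge0 //=.
  by rewrite ler_piMl ?invr_ge0 ?exprn_ge0 //; case: (_ == _).
move=> /(_ hu).
rewrite !mxE /= /series /= big_mkord.
rewrite (eq_bigr (fun l : 'I_L =>
  (net_word (trunc_mx S L w) (trunc_shift S L w) i j 0 l == 1)%:R / 2 ^+ l.+1)) //.
by move=> l _; rewrite net_digitE.
Qed.

Lemma cube_net_point i w : cube (net_point S C i w).
Proof.
move=> j; have := net_point_bounds 0 i j w.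
by rewrite [corner _ _ _ _]mxE big_ord0 subr0 expr0 invr1.
Qed.

(** The integration error for the digits truncated at L and the function
    replaced by its values at the corners of the dyadic cells. *)
Definition trunc_error L (M : {ffun 'I_s -> 'M['F_2]_(L, m)})
    (D : {ffun 'I_s -> 'rV['F_2]_L}) : R :=
  (2 ^ m)%:R^-1 * \sum_(i < 2 ^ m) f (corner R (net_word M D i)) -
  walsh_coef (fun x => f (corner R x)) (0 : {ffun 'I_s -> 'rV['F_2]_L}).

Let W : R := s%:R * K.

Lemma mu_hat_close L w :
  `|(mu_hat S C f w - cube_integral f) -
    trunc_error (trunc_mx S L w) (trunc_shift S L w)| <= 2 * W * 2 ^- L.
Proof.
have n0 : 0 < (2 ^ m)%:R :> R by rewrite ltr0n expn_gt0.
have h1 : `|mu_hat S C f w - (2 ^ m)%:R^-1 * \sum_(i < 2 ^ m)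
    f (corner R (net_word (trunc_mx S L w) (trunc_shift S L w) i))| <= W * 2 ^- L.
  rewrite /mu_hat -mulrBr -sumrB normrM gtr0_norm ?invr_gt0 // ler_pdivrMl //.
  apply: le_trans (ler_norm_sum _ _ _) _.
  rewrite -[X in X%:R * _]card_ord mulr_natl -sumr_const; apply: ler_sum => i _.
  apply: (cube_lipschitz hf KP (cube_net_point i w) (cube_corner R _)) => j.
  by have /andP[h0 h1] := net_point_bounds L i j w; rewrite ger0_norm.
have h2 := riemann hf KP L; rewrite /trunc_error.
move: h1 h2; set a := mu_hat _ _ _ _; set b := _^-1 * _; set c := cube_integral _.
set e := walsh_coef _ _ => h1 h2.
have -> : a - c - (b - e) = (a - b) - (c - e) by ring.
by apply: le_trans (ler_normB _ _) _; rewrite -/W in h2; lra.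
Qed.

Let err w := mu_hat S C f w - cube_integral f.

Lemma err_bounded : exists2 B, 0 <= B & forall w, `|err w| <= B.
Proof.
have K0 : 0 <= K by case: KP.
have c0 : cube (0 : 'rV[R]_s) by move=> j; rewrite mxE lexx ler01.
have fb x : cube x -> `|f x| <= `|f 0| + W.
  move=> cx; have := @cube_lipschitz _ _ _ hf _ KP x 0 1 cx c0.
  move=> /(_ _)/(le_trans (lerB_dist _ _)); rewrite lerBlDl mulr1; apply.
  by move=> j; have := cx j; rewrite mxE subr0 ler_norml; lra.
exists (`|f 0| + W + `|cube_integral f|) => [|w].
  by rewrite !addr_ge0 // mulr_ge0.
apply: le_trans (ler_normB _ _) _; rewrite lerD2r.
have n0 : 0 < (2 ^ m)%:R :> R by rewrite ltr0n expn_gt0.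
rewrite /mu_hat normrM gtr0_norm ?invr_gt0 // ler_pdivrMl //.
apply: le_trans (ler_norm_sum _ _ _) _.
rewrite -[X in X%:R * _]card_ord mulr_natl -sumr_const; apply: ler_sum => i _.
exact/fb/cube_net_point.
Qed.

Lemma cvg_half_pow (c : R) : (fun L : nat => c * 2 ^- L) @ \oo --> (0 : R).
Proof.
rewrite -[X in _ --> X](mulr0 c); apply: cvgMr.
under eq_fun do rewrite -exprVn.
by apply: cvg_expr; rewrite ger0_norm ?invr_ge0 // invf_lt1 ?ltr1n.
Qed.

Lemma measurable_err : measurable_fun setT err.
Proof.
apply: (@measurable_uniform_limit _ _ _ setT _
  (fun L w => trunc_error (trunc_mx S L w) (trunc_shift S L w))
  (fun L => 2 * W * 2 ^- L)).
- by move=> L; apply: measurable_trunc.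
- exact: cvg_half_pow.
- by move=> L w _; exact: mu_hat_close.
Qed.

(** The third moment is the limit of those of the truncated errors. *)
Lemma third_moment_le (Q : R) :
  (forall L, `|\sum_M \sum_D trunc_law S M D * @trunc_error L M D ^+ 3| <= Q) ->
  `|error_moment S C f 3| <= Q.
Proof.
move=> trunc_le; have [B B0 errB] := err_bounded.
have K0 : 0 <= K by case: KP.
have W0 : 0 <= W by rewrite mulr_ge0.
have Poo : (P setT < +oo)%E by rewrite probability_setT ltry.
pose E L w := trunc_error (trunc_mx S L w) (trunc_shift S L w).
have EB L w : `|E L w| <= B + 2 * W.
  have h1 := errB w; have := mu_hat_close L w; rewrite -/(err w) -/(E L w) => h2.
  have h3 : 2 ^- L <= 1 :> R by rewrite invf_le1 ?exprn_gt0 // exprn_ege1 // ler1n.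
  have h4 : 2 * W * 2 ^- L <= 2 * W by rewrite ler_piMr // mulr_ge0.
  have := ler_normB (err w) (err w - E L w).
  by rewrite opprB addrC subrK; lra.
set B' := B + 2 * W in EB.
have i3 : P.-integrable setT (EFin \o (fun w => err w ^+ 3)).
  apply: (@bounded_Rintegrable _ _ _ P setT measurableT Poo _ (B ^+ 3)).
    by apply: measurable_funX; exact: measurable_err.
  by move=> w _; rewrite normrX lerXn2r // nnegrE.
have iE L : P.-integrable setT (EFin \o (fun w => E L w ^+ 3)).
  apply: (@bounded_Rintegrable _ _ _ P setT measurableT Poo _ (B' ^+ 3)).
    by apply: measurable_funX; exact: measurable_trunc.
  by move=> w _; rewrite normrX lerXn2r // nnegrE // addr_ge0 ?mulr_ge0.
have close L : `|error_moment S C f 3| <= Q + 3 * B' ^+ 2 * (2 * W) * 2 ^- L.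
  have mE : error_moment S C f 3 = Rintegral P setT (fun w => err w ^+ 3).
    by rewrite /error_moment unlock.
  have tE : Rintegral P setT (fun w => E L w ^+ 3) =
      \sum_M \sum_D trunc_law S M D * @trunc_error L M D ^+ 3.
    exact: (trunc_expectation S (fun M D => @trunc_error L M D ^+ 3)).
  have := @Rintegral_dist _ _ _ P setT measurableT Poo _ _
    (3 * B' ^+ 2 * (2 * W) * 2 ^- L) i3 (iE L).
  rewrite [fine _](congr1 fine (probability_setT P)) /= mulr1 -mE tE => /(_ _) h.
  have := trunc_le L; set X := \sum_M _ => hX.
  have hd : `|error_moment S C f 3 - X| <= 3 * B' ^+ 2 * (2 * W) * 2 ^- L.
    apply: h => w _; set a := err w; set b := E L w.
    have ha : `|a| <= B' by apply: le_trans (errB w) _; rewrite lerDl mulr_ge0.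
    have hb : `|b| <= B' by exact: EB.
    have -> : a ^+ 3 - b ^+ 3 = (a ^+ 2 + a * b + b ^+ 2) * (a - b) by ring.
    rewrite normrM.
    have -> : 3 * B' ^+ 2 * (2 * W) * 2 ^- L =
      (3 * B' ^+ 2) * (2 * W * 2 ^- L) by rewrite !mulrA.
    apply: ler_pM => //; last exact: mu_hat_close.
    apply: le_trans (ler_normD _ _) _.
    apply: le_trans (lerD (ler_normD _ _) (lexx _)) _.
    have B'0 : 0 <= B' by apply: le_trans ha.
    have pw u v : `|u| <= B' -> `|v| <= B' -> `|u * v| <= B' ^+ 2.
      by move=> hu hv; rewrite normrM expr2 ler_pM.
    by have := pw _ _ ha ha; have := pw _ _ ha hb; have := pw _ _ hb hb;
      rewrite -!expr2; lra.
  have := ler_normD (error_moment S C f 3 - X) X; rewrite subrK; lra.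
rewrite -[Q]addr0.
have cv : (fun L : nat => Q + 3 * B' ^+ 2 * (2 * W) * 2 ^- L) @ \oo --> Q + 0.
  by apply: cvgD; [exact: cvg_cst|exact: cvg_half_pow].
rewrite -(cvg_lim _ cv) //; apply: limr_ge; first by apply/cvg_ex; exists (Q + 0).
by exists 0%N => // L _; exact: close.
Qed.

End truncated_error.

(** * The third moment *)

Lemma natcol_binval m (v : 'rV['F_2]_m) : natcol m (binval v) = v^T.
Proof. by apply/colP => c; rewrite !mxE binval_bit F2_bool. Qed.

Lemma sum_sg_natcol (R : realFieldType) m (z : 'rV['F_2]_m) :
  \sum_(i < 2 ^ m) sgF2 R ((z *m natcol m i) 0 0) = (2 ^ m)%:R * (z == 0)%:R.
Proof.
have bij := onW_bij _ (binord_bij m).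
rewrite (reindex (@binord m)) /=; last exact: bij.
under eq_bigr => v _ do rewrite natcol_binval.
have [->|z0] := eqVneq z 0.
  under eq_bigr => v _ do rewrite mul0mx mxE sgF20.
  by rewrite sumr_const card_mx mul1n card_ord mulr1.
rewrite mulr0.
have [c zc] : exists c, z 0 c = 1.
  have [c zc|noc] := pickP (fun c => z 0 c != 0).
    by exists c; apply/eqP; rewrite -F2_neq0.
  case/eqP: z0; apply/rowP => c; rewrite mxE.
  by have /negbT := noc c; rewrite negbK => /eqP.
set A := \sum_v _; suff : A = - A by lra.
rewrite {1}/A (reindex_inj (addIr (delta_mx 0 c))) /A -sumrN.
apply: eq_bigr => v _.
have -> : (z *m (v + delta_mx 0 c)^T) 0 0 = (z *m v^T) 0 0 + z 0 c.
  rewrite [(v + _)^T]linearD /= mulmxDr [in LHS]mxE; congr (_ + _).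
  rewrite trmx_delta delta_dot.
  by rewrite mxE eqxx mulr1n.
by rewrite sgF2D zc sgF21 mulrN1.
Qed.

Lemma cube_sum (R : comNzRingType) (I : finType) (u : I -> R) :
  (\sum_i u i) ^+ 3 = \sum_i \sum_j \sum_k u i * u j * u k.
Proof.
rewrite !exprS expr0 mulr1 mulr_suml; apply: eq_bigr => i _.
rewrite mulr_suml mulr_sumr; apply: eq_bigr => j _.
by rewrite !mulr_sumr; apply: eq_bigr => k _; rewrite mulrA.
Qed.

Section third_moment.
Context d (T : measurableType d) (R : realType) (P : probability T R).
Variables (s m : nat) (S : scrambling P s m) (C : gen_matrices s m).
Variables (f : 'rV[R]_s -> R) (hf : smooth2 f) (K : R) (KP : pd_bounded f K).
Variable L : nat.
Local Notation mats := {ffun 'I_s -> 'M['F_2]_(L, m)}.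
Local Notation words := {ffun 'I_s -> 'rV['F_2]_L}.
Implicit Types (k : words) (M : mats) (D : words).

Lemma walsh_net_word k M D i :
  walsh R k (net_word C M D i) =
  walsh R k D * sgF2 R ((zvec C k M *m natcol m i) 0 0).
Proof.
have -> : net_word C M D i = [ffun j => (M j *m C j *m natcol m i)^T] + D.
  by apply/ffunP => j; rewrite !ffunE.
rewrite walshDr mulrC; congr (_ * sgF2 _ _).
rewrite mulmx_suml summxE; apply: eq_bigr => j _.
by rewrite ffunE trmxK !mulmxA.
Qed.

Definition centered_coef k : R :=
  if k == 0 then 0 else walsh_coef (fun x => f (corner R x)) k.

(** Averaged over the points of the net, a Walsh function is either a sign that
    depends on the shift or zero, according to the event of its frequency. *)
Lemma trunc_error_walsh M D : trunc_error C f M D =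
  \sum_k centered_coef k * walsh R k D * (zvec C k M == 0)%:R.
Proof.
pose g := fun x : words => f (corner R x).
have n0 : (2 ^ m)%:R != 0 :> R by rewrite pnatr_eq0 expn_eq0.
have -> : trunc_error C f M D =
    \sum_k walsh_coef g k * walsh R k D * (zvec C k M == 0)%:R - walsh_coef g 0.
  rewrite /trunc_error; congr (_ - _).
  under eq_bigr => i _ do rewrite -/(g _) (walsh_inversion g (net_word C M D i)).
  rewrite exchange_big mulr_sumr; apply: eq_bigr => k _.
  under eq_bigr => i _ do rewrite walsh_net_word mulrA.
  by rewrite -mulr_sumr sum_sg_natcol; field.
have z0 : zvec C (0 : words) M = 0.
  by rewrite /zvec big1 // => j _; rewrite ffunE !mul0mx.
have w0 : walsh R (0 : words) D = 1.
  rewrite /walsh /dot big1 ?sgF20 // => j _.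
  by rewrite ffunE mul0mx mxE.
rewrite (bigD1 (0 : words)) //= [in RHS](bigD1 (0 : words)) //= z0 w0 eqxx /centered_coef eqxx.
rewrite !mulr1 add0r [LHS]addrC. rewrite addKr; apply: eq_bigr => k /negbTE k0.
by rewrite k0.
Qed.

Lemma shift_average M k :
  \sum_D trunc_law S M D * walsh R k D = (k == 0)%:R * mx_law S M.
Proof.
have lawE D : trunc_law S M D = trunc_law S M 0.
  rewrite -[M in LHS]addr0 -[D in LHS]add0r trunc_law_shift // => j l c _.
  by rewrite ffunE mxE.
rewrite (eq_bigr (fun D => trunc_law S M 0 * walsh R k D)); last first.
  by move=> D _; rewrite lawE.
rewrite -mulr_sumr; have [->|k0] := eqVneq k 0; last first.
  by rewrite sum_walsh_eq0 // mulr0 mul0r.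
rewrite mul1r /mx_law mulr_sumr; apply: eq_bigr => D _.
rewrite lawE /walsh /dot big1 ?sgF20 ?mulr1 // => j _.
by rewrite ffunE mul0mx mxE.
Qed.

(** Only the triples of frequencies that add up to zero survive the average
    over the digital shift. *)
Lemma third_moment_walsh :
  \sum_(M : mats) \sum_(D : words) trunc_law S M D * trunc_error C f M D ^+ 3 =
  \sum_k1 \sum_k2 centered_coef k1 * centered_coef k2 * centered_coef (k1 + k2) *
    pair_prob C (mx_law S (L := L)) k1 k2.
Proof.
pose z k M : R := (zvec C k M == 0)%:R.
have expand M D : trunc_law S M D * trunc_error C f M D ^+ 3 =
    \sum_k1 \sum_k2 \sum_k3
      centered_coef k1 * centered_coef k2 * centered_coef k3 *
      (z k1 M * z k2 M * z k3 M) * (trunc_law S M D * walsh R (k1 + k2 + k3) D).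
  have -> : trunc_error C f M D =
      \sum_k centered_coef k * walsh R k D * z k M by exact: trunc_error_walsh.
  rewrite cube_sum mulr_sumr; apply: eq_bigr => k1 _.
  rewrite mulr_sumr; apply: eq_bigr => k2 _.
  rewrite mulr_sumr; apply: eq_bigr => k3 _.
  rewrite !walshDl; clearbody z.
  move: (centered_coef k1) (centered_coef k2) (centered_coef k3).
  move: (z k1 M) (z k2 M) (z k3 M) (walsh R k1 D) (walsh R k2 D) (walsh R k3 D).
  by move: (trunc_law S M D); clear=> *; ring.
under eq_bigr => M _ do under eq_bigr => D _ do rewrite expand.
under eq_bigr => M _ do rewrite exchange_big.
rewrite exchange_big; apply: eq_bigr => k1 _ /=.
under eq_bigr => M _ do rewrite exchange_big.
rewrite exchange_big; apply: eq_bigr => k2 _ /=.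
under eq_bigr => M _ do rewrite exchange_big.
rewrite /pair_prob [in RHS]big_mkcond mulr_sumr; apply: eq_bigr => M _ /=.
have kk (k : words) : k + k = 0.
  by apply/ffunP => j; rewrite !ffunE rV2_addxx.
under eq_bigr => k3 _ do rewrite -mulr_sumr shift_average.
rewrite (bigD1 (k1 + k2)) //= big1 ?addr0; last first.
  move=> k3 k3n; rewrite (_ : (k1 + k2 + k3 == 0) = false) ?mul0r ?mulr0 //.
  apply/negbTE; apply: contraNneq k3n => k0.
  by rewrite -[k3]add0r -(kk (k1 + k2)) -addrA k0 addr0.
rewrite kk eqxx mul1r /z zvecDl.
by case: eqP => [->|_]; case: eqP => [->|_];
  rewrite ?addr0 ?eqxx /= ?(mulr1, mul1r, mul0r, mulr0).
Qed.

(** The products of three coefficients and of (4 beta)^D have a sum over all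
    pairs of frequencies that is bounded uniformly in L. *)
Lemma third_moment_bound (beta Q : R) : 0 <= beta < 1 -> 0 <= Q ->
  (forall k1 k2, k1 != 0 -> k2 != 0 -> k1 != k2 ->
     pair_prob C (mx_law S (L := L)) k1 k2 <=
       Q * (4 * beta) ^+ joint_degree k1 k2) ->
  `|\sum_(M : mats) \sum_(D : words) trunc_law S M D * trunc_error C f M D ^+ 3| <=
  K ^+ 3 * (Q * (3 * ((1 - beta) ^+ 2)^-1 ^+ 2) ^+ s).
Proof.
move=> b01 Q0 pQ; have b0 : 0 <= beta by case/andP: b01.
have K0 : 0 <= K by case: KP.
have cK k : `|centered_coef k| <= K * weights R k.
  rewrite /centered_coef; case: eqP => _; last exact: walsh_coef_bound.
  by rewrite normr0 mulr_ge0 // weights_ge0.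
have beta4 n : 0 <= (4 * beta) ^+ n by rewrite exprn_ge0 // mulr_ge0.
have p0 k1 k2 : 0 <= pair_prob C (mx_law S (L := L)) k1 k2.
  exact/pair_prob_ge0/mx_law_invariant.
rewrite third_moment_walsh.
apply: (@le_trans _ _ (K ^+ 3 * (Q * \sum_k1 \sum_k2
  weights R k1 * weights R k2 * weights R (k1 + k2) *
    (4 * beta) ^+ joint_degree k1 k2))); last first.
  rewrite ler_wpM2l ?exprn_ge0 // ler_wpM2l //; exact: sum_weights.
apply: le_trans (ler_norm_sum _ _ _) _; rewrite !mulr_sumr.
apply: ler_sum => k1 _; apply: le_trans (ler_norm_sum _ _ _) _.
rewrite !mulr_sumr; apply: ler_sum => k2 _.
set w1 := weights R k1; set w2 := weights R k2; set w3 := weights R (k1 + k2).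
set e := _ ^+ joint_degree k1 k2.
have w0 : [/\ 0 <= w1, 0 <= w2 & 0 <= w3] by rewrite !weights_ge0.
case: w0 => w10 w20 w30.
have rhs0 : 0 <= K ^+ 3 * (Q * (w1 * w2 * w3 * e)).
  by rewrite mulr_ge0 ?exprn_ge0 // !mulr_ge0 // beta4.
have [k10|k10] := eqVneq k1 0.
  by rewrite {1}/centered_coef k10 eqxx !mul0r normr0.
have [k20|k20] := eqVneq k2 0.
  by rewrite {2}/centered_coef k20 eqxx mulr0 !mul0r normr0.
have [k12|k12] := eqVneq k1 k2.
  rewrite [centered_coef (k1 + k2)]/centered_coef k12.
  have -> : k2 + k2 = 0 by apply/ffunP => j; rewrite !ffunE rV2_addxx.
  by rewrite eqxx mulr0 mul0r normr0.
rewrite !normrM (ger0_norm (p0 k1 k2)).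
have -> : K ^+ 3 * (Q * (w1 * w2 * w3 * e)) =
  ((K * w1) * (K * w2) * (K * w3)) * (Q * e) by ring.
apply: ler_pM => //; last exact: pQ.
by apply: ler_pM; rewrite ?mulr_ge0 //; apply: ler_pM.
Qed.

End third_moment.

(** * Damped bounds for the probabilities *)

Section zevent.
Context d (T : measurableType d) (R : realType) (P : probability T R).
Variables (s m : nat) (S : scrambling P s m) (C : gen_matrices s m) (L : nat).
Implicit Types k : {ffun 'I_s -> 'rV['F_2]_L}.

Definition freq k : {ffun 'I_s -> nat} := [ffun j => binval (k j)].

Lemma freq_inj : injective freq.
Proof.
move=> k k' /ffunP e; apply/ffunP => j; apply: binval_inj.
by have := e j; rewrite !ffunE.
Qed.

Lemma freq0 : freq 0 = [ffun=> 0%N].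
Proof.
apply/ffunP => j; rewrite !ffunE /binval big1 // => l _.
by rewrite mxE.
Qed.

Lemma bit_high n l : (n <= l)%N -> bit n l = false.
Proof.
by move=> nl; rewrite /bit divn_small // (leq_ltn_trans nl) // ltn_expl.
Qed.

(** The digits of the integer attached to k beyond L vanish, so that the event
    depends only on the first L rows. *)
Lemma ZeventE k :
  Zevent S C (freq k) = [set w | zvec C k (trunc_mx S L w) = 0].
Proof.
suff E w : \sum_j \sum_(l < freq k j) (bit (freq k j) l)%:R *:
    (scr_row S j l w *m C j) = zvec C k (trunc_mx S L w).
  by apply/seteqP; split => w; rewrite /Zevent /= E.
apply: eq_bigr => j _; rewrite !ffunE.
pose F l := (bit (binval (k j)) l)%:R *: (scr_row S j l w *m C j) : 'rV['F_2]_m.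
have widen n N : (n <= N)%N -> (forall l, (n <= l)%N -> bit (binval (k j)) l = false) ->
    \sum_(l < n) F l = \sum_(l < N) F l.
  move=> nN hi; rewrite -!(big_mkord xpredT) (big_cat_nat _ nN) //=.
  rewrite [X in _ + X]big_nat_cond [X in _ + X]big1 ?addr0 // => l.
  by rewrite andbT => /andP[nl _]; rewrite /F hi // scale0r.
rewrite -[LHS]/(\sum_(l < _) F l).
rewrite (widen _ (maxn (binval (k j)) L)) ?leq_maxl //; last exact: bit_high.
rewrite -(widen L) ?leq_maxr //; last exact: binval_high.
rewrite -mulmxA mulmx_sum_row; apply: eq_bigr => l _.
rewrite /F binval_bit F2_bool; congr (_ *: _).
rewrite row_mul; congr (_ *m _); apply/rowP => c.
by rewrite !mxE.
Qed.

Lemma measurable_Zevent k : measurable (Zevent S C (freq k)).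
Proof.
pose F (M : {ffun 'I_s -> 'M['F_2]_(L, m)}) (D : {ffun 'I_s -> 'rV['F_2]_L}) : R :=
  (zvec C k M == 0)%:R.
have -> : Zevent S C (freq k) =
    setT `&` (fun w => F (trunc_mx S L w) (trunc_shift S L w)) @^-1` [set 1].
  rewrite setTI ZeventE; apply/seteqP; split => w /=; rewrite /F.
    by move=> ->; rewrite eqxx.
  by case: eqP => // _ /eqP; rewrite eq_sym oner_eq0.
by apply: measurable_trunc.
Qed.

Lemma pair_prob_Zevent k1 k2 : pair_prob C (mx_law S (L := L)) k1 k2 =
  fine (P (Zevent S C (freq k1) `&` Zevent S C (freq k2))).
Proof.
pose F (M : {ffun 'I_s -> 'M['F_2]_(L, m)}) (D : {ffun 'I_s -> 'rV['F_2]_L}) : R :=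
  ((zvec C k1 M == 0) && (zvec C k2 M == 0))%:R.
set A := _ `&` _.
have AE w : F (trunc_mx S L w) (trunc_shift S L w) = \1_A w.
  rewrite /F indicE; congr (nat_of_bool _)%:R.
  rewrite /A !ZeventE in_setI; congr (_ && _).
    by apply/eqP/idP => [?|]; [rewrite inE|rewrite inE].
  by apply/eqP/idP => [?|]; [rewrite inE|rewrite inE].
have mA : measurable A by apply: measurableI; exact: measurable_Zevent.
have -> : fine (P A) = Rintegral P setT (fun w => F (trunc_mx S L w) (trunc_shift S L w)).
  rewrite /Rintegral; under eq_integral do rewrite AE.
  by rewrite integral_indic // setIT.
rewrite trunc_expectation /pair_prob big_mkcond; apply: eq_bigr => M _.
by rewrite /F; case: ifP => _; [apply: eq_bigr => D _; rewrite mulr1|rewrite big1 // => D _; rewrite mulr0].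
Qed.

End zevent.

Section exponents.
Context d (T : measurableType d) (R : realType) (P : probability T R).
Variables (s m : nat) (S : scrambling P s m) (C : gen_matrices s m) (L : nat).
Variables (t : nat) (sigma : R).
Hypotheses (s0 : (0 < s)%N) (netC : is_net C t) (sigma0 : 0 < sigma).
Hypothesis small : t%:R + s%:R <= sigma / 12 * m%:R :> R.
Implicit Types k : {ffun 'I_s -> 'rV['F_2]_L}.

(** The exponent spent per unit of joint degree to make the sum over all pairs
    of frequencies converge, small compared with the slack sigma. *)
Definition damping : R := Num.min (1 / 2) (sigma / 8).

Let delta := damping.

Let delta_bounds : 0 < delta <= 1 / 2 /\ delta <= sigma / 8.
Proof.
have s8 : 0 < sigma / 8 by rewrite divr_gt0.
by rewrite /delta /damping lt_min s8 !ge_min !lexx orbT divr_gt0.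
Qed.

Let law_inv := mx_law_invariant S L.
Let law_supp := mx_law_supp (S := S) (L := L).

Let inv_pow (p : R) (r : nat) : p * 2 ^+ r <= 1 -> p <= 2 `^ (- r%:R).
Proof. by rewrite powRN powR_mulrn // -ler_pdivlMr ?exprn_gt0 // div1r. Qed.

Lemma pair_prob_damped (rho e : R) k1 k2 : rho <= 6 - sigma -> 0 <= e ->
  (pair_prob C (mx_law S (L := L)) k1 k2 != 0 ->
    rho * m%:R + sigma / 2 * m%:R <= e + 2 * (joint_degree k1 k2)%:R) ->
  pair_prob C (mx_law S (L := L)) k1 k2 <= 2 `^ (- e) ->
  pair_prob C (mx_law S (L := L)) k1 k2 <=
    2 `^ (- (rho * m%:R)) * (4 * 2 `^ (- delta)) ^+ joint_degree k1 k2.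
Proof.
move=> rho6 e0 he hp; have [p0|p0] := eqVneq (pair_prob C (mx_law S (L := L)) k1 k2) 0.
  by rewrite p0 mulr_ge0 ?powR_ge0 ?exprn_ge0 ?mulr_ge0 ?powR_ge0.
have [/andP[d0 d1] d2] := delta_bounds.
apply: (damped_bound _ e0) => //.
- by rewrite ltW.
- lra.
- have m0 : 0 <= m%:R :> R by [].
  have := he p0; nra.
Qed.

Lemma damped_general (eps : R) k1 k2 : sigma = eps ->
  k1 != 0 -> k2 != 0 -> k1 != k2 ->
  pair_prob C (mx_law S (L := L)) k1 k2 <=
    2 `^ (- ((9 / 2 - eps) * m%:R)) * (4 * 2 `^ (- delta)) ^+ joint_degree k1 k2.
Proof.
move=> sE k10 k20 k12.
have [p0|p0] := eqVneq (pair_prob C (mx_law S (L := L)) k1 k2) 0.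
  by rewrite p0 mulr_ge0 ?powR_ge0 ?exprn_ge0 ?mulr_ge0 ?powR_ge0.
have [r pr hr] := pair_prob_general s0 netC law_inv law_supp k10 k20 k12 p0.
apply: (@pair_prob_damped _ r%:R) => //; [lra| |exact: inv_pow].
move=> _; move: hr; rewrite -(ler_nat R) !(natrM, natrD).
by move: small; rewrite sE; lra.
Qed.

Lemma damped_le2 (eps : R) k1 k2 : (s <= 2)%N -> sigma = eps ->
  k1 != 0 -> k2 != 0 -> k1 != k2 ->
  pair_prob C (mx_law S (L := L)) k1 k2 <=
    2 `^ (- ((5 - eps) * m%:R)) * (4 * 2 `^ (- delta)) ^+ joint_degree k1 k2.
Proof.
move=> s2 sE k10 k20 k12.
have [p0|p0] := eqVneq (pair_prob C (mx_law S (L := L)) k1 k2) 0.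
  by rewrite p0 mulr_ge0 ?powR_ge0 ?exprn_ge0 ?mulr_ge0 ?powR_ge0.
have [r pr hr] := pair_prob_le2 s0 netC law_inv law_supp s2 k10 k20 k12 p0.
apply: (@pair_prob_damped _ r%:R) => //; [lra| |exact: inv_pow].
move=> _; move: hr; rewrite -(ler_nat R) !(natrM, natrD).
by move: small; rewrite sE; lra.
Qed.

(** Here the joint degree is only known to be at least 3(m - t)/2, and the rest
    comes from the hypothesis on the probabilities. *)
Lemma damped_Cstar (eps eps' : R) k1 k2 : sigma = eps - 2 * eps' -> 0 < eps' ->
  Cstar S eps' C ->
  k1 != 0 -> k2 != 0 -> k1 != k2 ->
  pair_prob C (mx_law S (L := L)) k1 k2 <=
    2 `^ (- ((5 - eps) * m%:R)) * (4 * 2 `^ (- delta)) ^+ joint_degree k1 k2.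
Proof.
move=> sE e'0 [_ starC] k10 k20 k12.
have m0 : 0 <= m%:R :> R by [].
have hp : pair_prob C (mx_law S (L := L)) k1 k2 <= 2 `^ (- (2 * (1 - eps') * m%:R)).
  rewrite pair_prob_Zevent -lee_fin fineK ?fin_num_measure //; last first.
    by apply: measurableI; exact: measurable_Zevent.
  apply: starC; rewrite -?(freq0 s L) ?(inj_eq (@freq_inj s L)) //.
(* The exponent is negative when eps' > 1; then the bound 1 is used. *)
apply: (@pair_prob_damped _ (Num.max 0 (2 * (1 - eps') * m%:R))).
- lra.
- by rewrite le_max lexx.
- move=> p0; have := joint_degree_ge s0 netC law_supp k10 k20 k12 p0.
  rewrite -(ler_nat R) !(natrM, natrD) => hD.
  have : 2 * (1 - eps') * m%:R <= Num.max 0 (2 * (1 - eps') * m%:R).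
    by rewrite le_max lexx orbT.
  have s1 : 0 <= s%:R :> R by [].
  have sm : 0 <= (eps - 2 * eps') * m%:R by rewrite -sE mulr_ge0 // ltW.
  by move: small; rewrite sE; lra.
- rewrite /Num.max; case: ifP => _ //.
  rewrite oppr0 powRr0; exact: pair_prob_le1.
Qed.

End exponents.

(** * Skewness *)

Lemma near_linear_ge (R : realType) (a b : R) : 0 < a ->
  \forall m \near \oo, b <= a * m%:R.
Proof.
move=> a0; near=> m; rewrite mulrC -ler_pdivrMr //.
by near: m; exact: nbhs_infty_ger.
Unshelve. all: by end_near. Qed.

Lemma near_log_le (R : realType) (c eta : R) : 0 <= c -> 0 < eta ->
  \forall m \near \oo, c * (ln m%:R / ln 2) <= eta * m%:R.
Proof.
move=> c0 eta0; have l2 : 0 < ln 2 :> R by rewrite ln_gt0 // ltr1n.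
pose c' := (c + 1) / ln 2; have c'0 : 0 < c' by apply: divr_gt0 => //; lra.
pose a := eta / 2 / c'; have a0 : 0 < a by rewrite /a divr_gt0 // divr_gt0.
near=> m.
have m0 : 0 < m%:R :> R by rewrite ltr0n; near: m; exists 1%N.
(* From ln (a m) < a m, where a is as small as required. *)
have lnm : ln m%:R <= a * m%:R - ln a.
  rewrite lerBrDl -lnM ?posrE //; apply: ltW; apply: ln_sublinear.
  by rewrite mulr_gt0.
have lm0 : 0 <= ln m%:R :> R by rewrite ln_ge0 // ler1n -(ltr0n R).
apply: (@le_trans _ _ (c' * ln m%:R)).
  rewrite /c' mulrA [_ * ln _ / _]mulrAC ler_wpM2r //.
  by rewrite ler_wpM2r ?invr_ge0 ?(ltW l2) // lerDl.
apply: (@le_trans _ _ (c' * (a * m%:R - ln a))); first by rewrite ler_pM2l.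
have -> : c' * (a * m%:R - ln a) = eta / 2 * m%:R - c' * ln a.
  by rewrite /a; field; rewrite gt_eqF.
rewrite lerBlDr -lerBlDl.
have -> : eta / 2 * m%:R - eta * m%:R = - (eta / 2 * m%:R) by field.
rewrite lerNl; near: m; apply: near_linear_ge; exact: divr_gt0.
Unshelve. all: by end_near. Qed.

Section asymptotics.
Context (R : realType) d (T : measurableType d) (P : probability T R) (s : nat).
Variables (f : 'rV[R]_s -> R) (hf : smooth2 f).
Variables (S : forall m : nat, scrambling P s m).
Variables (C : forall m : nat, gen_matrices s m).

Let damped_at (sigma rho : R) (m : nat) : Prop :=
  forall L (k1 k2 : {ffun 'I_s -> 'rV['F_2]_L}), k1 != 0 -> k2 != 0 -> k1 != k2 ->
    pair_prob (C m) (mx_law (S m) (L := L)) k1 k2 <=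
    2 `^ (- (rho * m%:R)) * (4 * 2 `^ (- damping sigma)) ^+ joint_degree k1 k2.

Let third_moment_decay (sigma rho : R) : 0 < sigma -> exists2 A : R, 0 <= A &
  forall m, damped_at sigma rho m ->
    `|error_moment (S m) (C m) f 3| <= A * 2 `^ (- (rho * m%:R)).
Proof.
move=> sigma0; have [K KP] := smooth2_bounded hf; have K0 : 0 <= K by case: KP.
have d0 : 0 < damping sigma by rewrite /damping lt_min !divr_gt0.
set beta : R := 2 `^ (- damping sigma).
have b01 : 0 <= beta < 1.
  rewrite powR_ge0 /beta /powR pnatr_eq0 /= expR_lt1 mulNr oppr_lt0.
  by rewrite mulr_gt0 // ln_gt0 // ltr1n.
exists (K ^+ 3 * (3 * ((1 - beta) ^+ 2)^-1 ^+ 2) ^+ s) => [|m damped].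
  by rewrite mulr_ge0 ?exprn_ge0 // mulr_ge0 // exprn_ge0 // invr_ge0 sqr_ge0.
rewrite -mulrA [_ ^+ s * _]mulrC.
apply: (third_moment_le hf KP) => L.
by apply: third_moment_bound => //; exact: damped.
Qed.

Hypothesis hpos : forall m, (0 < m)%N -> 0 < error_moment (S m) (C m) f 2.
Hypothesis hvar : (fun m : nat => (2 ^ m)%:R ^- 3 : R)
              =O_\oo (fun m : nat => error_moment (S m) (C m) f 2).

(** Dividing the decay of the third moment by that of the variance. *)
Lemma skewness_bigO (sigma rho e : R) : 0 < sigma -> e = 9 / 2 - rho ->
  (\forall m \near \oo, damped_at sigma rho m) ->
  (fun m : nat => skewness (S m) (C m) f) =O_\oo
    (fun m : nat => (2 ^ m)%:R `^ e : R).
Proof.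
move=> sigma0 eE damped.
have [A A0 decay] := third_moment_decay rho sigma0.
have [c c0 varc] : exists2 c : R, 0 < c & \forall m \near \oo,
    `|(2 ^ m)%:R ^- 3 : R| <= c * `|error_moment (S m) (C m) f 2|.
  by move/eqO_exP: hvar => [c c0 h]; exists c.
apply/eqO_exP; exists (A * c `^ (3 / 2) + 1).
  by rewrite ltr_wpDl // mulr_ge0 ?powR_ge0.
near=> m.
have m0 : (0 < m)%N by near: m; exists 1%N.
have E2 := hpos m0.
have p2 : (2 ^ m)%:R = 2 `^ m%:R :> R by rewrite powR_mulrn // natrX.
have n0 : 0 < (2 ^ m)%:R :> R by rewrite ltr0n expn_gt0.
have h2 : `|(2 ^ m)%:R ^- 3 : R| <= c * `|error_moment (S m) (C m) f 2|.
  by near: m.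
have h3 : `|error_moment (S m) (C m) f 3| <= A * 2 `^ (- (rho * m%:R)).
  by apply: decay; near: m.
rewrite (gtr0_norm E2) ger0_norm ?invr_ge0 ?exprn_ge0 // in h2.
set E := error_moment _ _ _ 2 in E2 h2 *.
have Epow : 0 < E `^ (3 / 2) by exact: powR_gt0.
have h2' : 2 `^ (- (9 / 2 * m%:R)) <= c `^ (3 / 2) * E `^ (3 / 2).
  rewrite -powRM ?(ltW c0) ?(ltW E2) //.
  have -> : 2 `^ (- (9 / 2 * m%:R)) = ((2 ^ m)%:R ^- 3) `^ (3 / 2) :> R.
    rewrite p2 -powR_mulrn ?powR_ge0 // -powRrM -powRN -powRrM; congr (_ `^ _).
    by field.
  by apply: ge0_ler_powR => //; rewrite ?nnegrE ?divr_ge0 ?invr_ge0 ?exprn_ge0 ?mulr_ge0 ?(ltW c0) ?(ltW E2).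
rewrite /skewness normrM normfV (gtr0_norm Epow).
rewrite (ger0_norm (powR_ge0 _ _)) ler_pdivrMr //.
apply: le_trans h3 _.
have -> : 2 `^ (- (rho * m%:R)) = (2 ^ m)%:R `^ e * 2 `^ (- (9 / 2 * m%:R)) :> R.
  rewrite p2 -powRrM -powRD; last by rewrite pnatr_eq0 implybT.
  by congr (_ `^ _); rewrite eE; field.
have q0 : 0 <= (2 ^ m)%:R `^ e :> R by exact: powR_ge0.
have h4 : A * ((2 ^ m)%:R `^ e * 2 `^ (- (9 / 2 * m%:R))) <=
    A * ((2 ^ m)%:R `^ e * (c `^ (3 / 2) * E `^ (3 / 2))).
  by rewrite !ler_wpM2l.
apply: le_trans h4 _.
have -> : A * ((2 ^ m)%:R `^ e * (c `^ (3 / 2) * E `^ (3 / 2))) =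
  A * c `^ (3 / 2) * (2 ^ m)%:R `^ e * E `^ (3 / 2) by ring.
by rewrite ler_wpM2r ?(ltW Epow) // ler_wpM2r // lerDl.
Unshelve. all: by end_near. Qed.

Hypothesis s0 : (0 < s)%N.

Lemma near_small_t (t : nat) (sigma : R) : 0 < sigma ->
  \forall m \near \oo, t%:R + s%:R <= sigma / 12 * m%:R :> R.
Proof. by move=> sigma0; apply: near_linear_ge; rewrite divr_gt0. Qed.

Lemma near_small_t_value (sigma eps' : R) : 0 < sigma ->
  \forall m \near \oo, Cstar (S m) eps' (C m) ->
    (t_value (C m))%:R + s%:R <= sigma / 12 * m%:R :> R.
Proof.
move=> sigma0; have h : 0 < sigma / 24 by rewrite divr_gt0.
near=> m => -[t_small _].
have h1 : s%:R * (ln m%:R / ln 2) <= sigma / 24 * m%:R :> R.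
  by near: m; exact: near_log_le.
have h2 : s%:R <= sigma / 24 * m%:R :> R by near: m; exact: near_linear_ge.
by move: t_small; lra.
Unshelve. all: by end_near. Qed.

Lemma t_value_net m : is_net (C m) (t_value (C m)).
Proof. by rewrite /t_value; case: ex_minnP. Qed.

End asymptotics.

Theorem mainTheorem2 (R : realType) (d : measure_display)
    (T : measurableType d) (P : probability T R) (s : nat) (hs : (0 < s)%N)
    (f : 'rV[R]_s -> R) (hf : smooth2 f)
    (S : forall m : nat, scrambling P s m)
    (C : forall m : nat, gen_matrices s m)
    (hpos : forall m : nat, (0 < m)%N -> 0 < error_moment (S m) (C m) f 2)
    (hvar : (fun m : nat => (2 ^ m)%:R ^- 3 : R)
              =O_\oo (fun m : nat => error_moment (S m) (C m) f 2)) :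
  let gamma := fun m : nat => skewness (S m) (C m) f in
  let bounded_t := exists t : nat, \forall m \near \oo, is_net (C m) t in
  (bounded_t -> forall eps : R, 0 < eps ->
     gamma =O_\oo (fun m : nat => (2 ^ m)%:R `^ eps)) /\
  (forall eps : R, 0 < eps ->
     ((s <= 2)%N /\ bounded_t) \/
     (exists eps' : R, [/\ 0 < eps', eps' < eps / 2 &
        \forall m \near \oo, Cstar (S m) eps' (C m)]) ->
     gamma =O_\oo (fun m : nat => (2 ^ m)%:R `^ (- (1 / 2) + eps))).
Proof.
move=> gamma bounded_t; split=> [[t net] eps eps0|eps eps0 []].
- apply: (skewness_bigO hf hpos hvar (sigma := eps) (rho := 9 / 2 - eps)) => //.
    by lra.
  have small := near_small_t s t eps0.
  near=> m => L k1 k2 k10 k20 k12.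
  have netm : is_net (C m) t by near: m.
  by apply: (damped_general _ hs netm eps0) => //; near: m.
- move=> [s2 [t net]].
  apply: (skewness_bigO hf hpos hvar (sigma := eps) (rho := 5 - eps)) => //.
    by lra.
  have small := near_small_t s t eps0.
  near=> m => L k1 k2 k10 k20 k12.
  have netm : is_net (C m) t by near: m.
  by apply: (damped_le2 _ hs netm eps0) => //; near: m.
- move=> [eps' [e'0 e'eps star]].
  have sigma0 : 0 < eps - 2 * eps' by lra.
  apply: (skewness_bigO hf hpos hvar (sigma := eps - 2 * eps') (rho := 5 - eps)) => //.
    by lra.
  have small := near_small_t_value S C eps' sigma0.
  near=> m => L k1 k2 k10 k20 k12.
  have starm : Cstar (S m) eps' (C m) by near: m.
  have smallm : (t_value (C m))%:R + s%:R <= (eps - 2 * eps') / 12 * m%:R :> R.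
    by move: starm; near: m.
  exact: (damped_Cstar hs (t_value_net C m) sigma0 smallm (erefl _) e'0 starm).
Unshelve. all: by end_near. Qed.
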